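(* Let $\{\phi_n\}_{n=1}^{\infty}$ be a complete orthonormal system on $\mathbb{T}$. Then there exists a function $f\in L^\infty(\mathbb{T})$ such that $\|S[f]\|_{V^2}(x)=\infty$ for almost every $x\in\mathbb{T}$.
   Context: $\mathbb{T}=[0,1]$ with Lebesgue measure. An orthonormal system (ONS) is an ordered sequence $\{\phi_n\}_{n\in\mathbb{N}}$ of real or complex valued functions orthonormal in $L^2(\mathbb{T})$; it is complete if its linear span is dense in $L^2(\mathbb{T})$. For $f\in L^2(\mathbb{T})$ put $a_n=\langle f,\phi_n\rangle$ and $S_m[f](x)=\sum_{n=1}^{m}a_n\phi_n(x)$. Then $\|S[f]\|_{V^2}(x)=\sup_K\sup_{n_0<\dots<n_K}\left(\sum_{l=1}^{K}|S_{n_l}[f](x)-S_{n_{l-1}}[f](x)|^2\right)^{1/2}$. *)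

(* Defs.v *)
(* MathComp-Analysis, with the complex numbers R[i] of mathcomp-real-closed. *)
From HB Require Import structures.
From mathcomp Require Import all_boot all_order all_algebra.
From mathcomp Require Import all_classical all_reals all_analysis.
From mathcomp Require Import complex.

Set Implicit Arguments.
Unset Strict Implicit.
Unset Printing Implicit Defensive.
Import Order.TTheory GRing.Theory Num.Theory.
Import numFieldNormedType.Exports.

Local Open Scope classical_set_scope.
Local Open Scope complex_scope.
Local Open Scope ring_scope.

(* Real-valued and complex-valued systems are treated uniformly: every function
   takes values in R[i], and in the real case all functions and all coefficients
   are required to lie in the real axis. *)
Variant scalars := RealScalars | ComplexScalars.

Section Defs.
Context {R : realType}.
Implicit Types (K : scalars) (f g : R -> R[i]) (phi : nat -> R -> R[i]).

Definition in_scalars K (z : R[i]) : Prop :=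
  if K is RealScalars then z \is Num.real else True.

(* Functions on [0, 1] are functions on R whose values outside of [0, 1] are
   irrelevant. *)
Definition T01 : set R := `[0, 1].

Definition cmod (z : R[i]) : R := complex.Re `|z|.

Definition cLnorm (p : \bar R) f : \bar R :=
  Lnorm lebesgue_measure p ((EFin \o cmod \o f) \_ T01).

(* f represents an element of the real or complex space L^p([0, 1]) *)
Definition inLp K (p : \bar R) f : Prop :=
  [/\ forall x, T01 x -> in_scalars K (f x),
      measurable_fun T01 (@complex.Re R \o f),
      measurable_fun T01 (@complex.Im R \o f)
    & (cLnorm p f < +oo)%E].

Definition cintegral f : R[i] :=
  (\int[lebesgue_measure]_(x in T01) complex.Re (f x))
  +i* (\int[lebesgue_measure]_(x in T01) complex.Im (f x)).

Definition inner f g : R[i] := cintegral (fun x => f x * (g x)^*).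

(* Sequences are indexed from 0: phi k is the function usually written
   phi_(k+1). *)
Definition orthonormal_system K phi : Prop :=
  (forall n, inLp K 2%:E (phi n)) /\
  (forall m n, inner (phi m) (phi n) = (m == n)%:R).

Definition complete_system K phi : Prop :=
  forall g, inLp K 2%:E g -> forall e : R, 0 < e ->
  exists N (c : nat -> R[i]), (forall k, in_scalars K (c k)) /\
    (cLnorm 2%:E (fun x => g x - \sum_(k < N) c k * phi k x)%R < e%:E)%E.

(* Because of the index shift, the value at m is the sum of the first m+1 terms,
   so that m : nat ranges over exactly the partial sums S_1, S_2, S_3, ... *)
Definition partial_sum phi f (m : nat) (x : R) : R[i] :=
  \sum_(k < m.+1) inner f (phi k) * phi k x.

(* The pointwise 2-variation of a sequence of functions. *)
Definition V2 (S : nat -> R -> R[i]) (x : R) : \bar R :=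
  ereal_sup [set v | exists (L : nat) (n : nat -> nat),
    (forall l, (l < L)%N -> (n l < n l.+1)%N) /\
    v = (Num.sqrt (\sum_(l < L) cmod (S (n l.+1) x - S (n l) x) ^+ 2))%:E].

End Defs.

(* Main.v *)
Require Import Defs.
From HB Require Import structures.
From mathcomp Require Import all_boot all_order all_algebra.
From mathcomp Require Import all_classical all_reals all_analysis.
From mathcomp Require Import measurable_realfun ess_sup_inf complex ring lra.

Set Implicit Arguments.
Unset Strict Implicit.
Unset Printing Implicit Defensive.
Import Order.TTheory GRing.Theory Num.Theory.
Import numFieldNormedType.Exports.

Local Open Scope classical_set_scope.
Local Open Scope ring_scope.

(** The function is the limit of a uniformly bounded dyadic martingale whose
   quadratic variation over suitable subsequences of indices is infinite almost
   everywhere, and which the partial sums of the expansion of the limit follow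
   closely.

   The martingale. For the simple random walk of length 2^j, look at the dyadic
   blocks of steps on which the squared increment is at least A times the length
   of the block. A proportion of at least c > 0 of all blocks of any given large
   length is so exceptional (fourth moment, then repeated doubling: [walk_tail]), and the
   increments over disjoint blocks are independent, so the expected proportion of
   times that no exceptional block covers decays geometrically in j
   ([avg_uncovered]). The maximal exceptional blocks are disjoint; choosing their
   end points as indices gives a quadratic variation of about A times the
   variance of the walk. Since A is arbitrary, a rescaled walk, stopped when it
   becomes large, is bounded by e and has quadratic variation at least 1 with
   probability at least 1 - e ([bounded_walk_large_variation]). Running
   one such walk after the other with e = 2^-i gives a bounded martingale F(b_0 b_1 ...),
   a function of a sequence of bits, that infinitely often gains 1
   ([martingale_infinite_variation]).

   Transfer to the orthonormal system phi. The bits are taken to be binary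
   digits of x, in positions n_0 < n_1 < ... chosen one at a time; any such
   digits are independent fair bits under Lebesgue measure ([int_bits]). The
   k-th increment of the martingale is a function of the previous digits times a
   Rademacher function; by Bessel's inequality for the Rademacher functions, n_k
   can be chosen so large that this increment has tiny coefficients with respect
   to the functions of index at most M_k, already used ([small_coefs]). Then, by
   completeness of phi, M_(k+1) > M_k is chosen such that the partial sum of
   order M_(k+1) of the first k+1 increments is close to their sum in L^2
   ([partial_sum_cvg]). The partial sum of order M_k of the limit then differs
   from the martingale at time k by an error whose squared L^2 norm is O(2^-k).
   Hence the errors are square summable at almost every x
   ([ae_square_summable]) and cannot destroy the infinite quadratic variation
   ([var_perturb], [V2_infinite]). *)

(** * Averages over the discrete cube *)

Section Avg.
Context {R : realType}.
Implicit Types (f g : seq bool -> R) (s t : seq bool).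

(** The mean of [f] over the 2^n bit sequences of length [n]. *)
Fixpoint avg n (f : seq bool -> R) : R :=
  if n is n'.+1 then
    (avg n' (fun s => f (true :: s)) + avg n' (fun s => f (false :: s))) / 2
  else f [::].

Lemma avg_le n f g :
  (forall s, size s = n -> f s <= g s) -> avg n f <= avg n g.
Proof.
elim: n f g => [|n IH] f g fg /=; first exact: fg.
by rewrite ler_pM2r ?invr_gt0// lerD// IH// => s sn; apply: fg; rewrite /= sn.
Qed.

Lemma eq_avg n f g :
  (forall s, size s = n -> f s = g s) -> avg n f = avg n g.
Proof.
by move=> fg; apply/eqP; rewrite eq_le !avg_le// => s /fg ->.
Qed.

Lemma avgD n f g : avg n (fun s => f s + g s) = avg n f + avg n g.
Proof. by elim: n f g => [|n IH] f g //=; rewrite !IH; field. Qed.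

Lemma avgZ n c f : avg n (fun s => c * f s) = c * avg n f.
Proof. by elim: n f => [|n IH] f //=; rewrite !IH; field. Qed.

Lemma avg_cst n (c : R) : avg n (fun=> c) = c.
Proof. by elim: n => [|n IH] //=; rewrite !IH; field. Qed.

Lemma avg_cat m n f :
  avg (m + n) f = avg m (fun s => avg n (fun t => f (s ++ t))).
Proof. by elim: m f => [|m IH] f //=; rewrite !IH. Qed.

Lemma avg_rcons n f :
  avg n.+1 f = avg n (fun s => (f (rcons s true) + f (rcons s false)) / 2).
Proof.
by rewrite -addn1 avg_cat; apply: eq_avg => s _ /=; rewrite !cats1.
Qed.

Lemma avg_negb n f : avg n (fun s => f (map negb s)) = avg n f.
Proof.
elim: n f => [|n IH] f //=.
by rewrite (IH (fun s => f (false :: s))) (IH (fun s => f (true :: s))) addrC.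
Qed.

Lemma avg_indep m n f g :
  avg m (fun s => avg n (fun t => f s * g t)) = avg m f * avg n g.
Proof.
transitivity (avg m (fun s => avg n g * f s)).
  by apply: eq_avg => s _; rewrite avgZ mulrC.
by rewrite avgZ mulrC.
Qed.

Lemma avg_ge0 n f : (forall s, size s = n -> 0 <= f s) -> 0 <= avg n f.
Proof. by move=> f0; rewrite -[leLHS](avg_cst n 0); exact: avg_le. Qed.

End Avg.

(** * The simple random walk and its exceptional blocks *)

Section Walk.
Context {R : realType}.
Implicit Types (s t : seq bool).

(** The indicator of a boolean, as a real number. *)
Definition ind (b : bool) : R := b%:R.
(** The step +1 or -1 coded by a bit. *)
Definition sgb (b : bool) : R := if b then 1 else -1.
(** The position of the walk after the steps coded by [s], starting from 0. *)
Definition walk s : R := \sum_(b <- s) sgb b.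

Lemma walk_cons b s : walk (b :: s) = sgb b + walk s.
Proof. by rewrite /walk big_cons. Qed.

Lemma walk_cat s t : walk (s ++ t) = walk s + walk t.
Proof. by rewrite /walk big_cat. Qed.

Lemma walk_rcons s b : walk (rcons s b) = walk s + sgb b.
Proof. by rewrite -cats1 walk_cat walk_cons /walk big_nil addr0. Qed.

Lemma walk_negb s : walk (map negb s) = - walk s.
Proof.
elim: s => [|b s IH]; first by rewrite /walk big_nil oppr0.
by rewrite /= !walk_cons IH opprD; case: b; rewrite /= ?opprK.
Qed.

Lemma avg_walk2 n : avg n (fun s => walk s ^+ 2) = n%:R.
Proof.
elim: n => [|n IH] /=; first by rewrite /walk big_nil expr0n.
have e b : avg n (fun s => walk (b :: s) ^+ 2) =
    avg n (fun s => walk s ^+ 2) + avg n (fun s => 2 * sgb b * walk s) + 1.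
  rewrite -avgD -[X in _ = _ + X](avg_cst n) -avgD; apply: eq_avg => s _.
  by rewrite walk_cons; case: b; rewrite /sgb; ring.
by rewrite !e !avgZ IH /sgb -addn1 natrD; field.
Qed.

Lemma avg_walk4 n : avg n (fun s => walk s ^+ 4) = 3 * n%:R ^+ 2 - 2 * n%:R.
Proof.
elim: n => [|n IH] /=; first by rewrite /walk big_nil !expr0n/= !mulr0 subr0.
rewrite -avgD.
have -> : avg n (fun s => walk (true :: s) ^+ 4 + walk (false :: s) ^+ 4) =
   avg n (fun s => 2 * walk s ^+ 4 + (12 * walk s ^+ 2 + 2)).
  by apply: eq_avg => s _; rewrite !walk_cons /sgb; ring.
by rewrite !avgD !avgZ IH avg_walk2 avg_cst -addn1 natrD; field.
Qed.

(** A Paley-Zygmund estimate: the squared position X^2 has mean n and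
   second moment at most 3 n^2. *)
Lemma walk_tail0 n : (0 < n)%N ->
  16^-1 <= avg n (fun s => ind (n%:R / 4 <= walk s ^+ 2)).
Proof.
move=> n0; have n0' : 0 < n%:R :> R by rewrite ltr0n.
(* (X^2 - n/4)(4n - X^2) is negative for X^2 < n/4 and never exceeds 4 n^2,
   while its mean is at least n^2 / 4. *)
have : avg n (fun s => (walk s ^+ 2 - n%:R / 4) * (4 * n%:R - walk s ^+ 2))
   <= avg n (fun s => 4 * n%:R ^+ 2 * ind (n%:R / 4 <= walk s ^+ 2)).
  apply: avg_le => s _; rewrite /ind; case: (leP (n%:R / 4) (walk s ^+ 2)) => h /=.
    by rewrite mulr1; have := sqr_ge0 (walk s ^+ 2 - 17 / 8 * n%:R); nra.
  rewrite mulr0; nra.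
rewrite avgZ.
have -> : avg n (fun s => (walk s ^+ 2 - n%:R / 4) * (4 * n%:R - walk s ^+ 2))
  = avg n (fun s => (-1) * walk s ^+ 4 + (17 / 4 * n%:R * walk s ^+ 2 +
      (- n%:R ^+ 2))).
  by apply: eq_avg => s _; field.
rewrite !avgD !avgZ avg_walk4 avg_walk2 avg_cst.
set p := avg n _ => h.
have : n%:R ^+ 2 * 4^-1 <= n%:R ^+ 2 * (4 * p) by nra.
rewrite ler_pM2l ?exprn_gt0// => h'; lra.
Qed.

(** Two independent halves are both large and of the same sign with at least
   half the squared probability that one of them is large. *)
Lemma walk_tail_double n (L : R) : 0 <= L ->
  avg n (fun s => ind (L <= walk s ^+ 2)) ^+ 2 / 2 <=
  avg (n + n) (fun s => ind (4 * L <= walk s ^+ 2)) :> R.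
Proof.
move=> L0.
pose p := avg n (fun s => ind (L <= walk s ^+ 2)).
pose P s : R := ind ((L <= walk s ^+ 2) && (0 <= walk s)).
pose Q s : R := ind ((L <= walk s ^+ 2) && (walk s <= 0)).
have PQ : avg n Q = avg n P.
  rewrite -avg_negb; apply: eq_avg => s _.
  by rewrite /P /Q /ind walk_negb sqrrN oppr_le0.
case: (L =P 0) => [->|/eqP L0'].
  rewrite mulr0; under [X in X ^+ 2]eq_avg do rewrite sqr_ge0.
  under [leRHS]eq_avg do rewrite sqr_ge0.
  by rewrite !avg_cst /ind /=; lra.
have {L0 L0'}L0 : 0 < L by rewrite lt_neqAle eq_sym L0'.
have pP : p = 2 * avg n P.
  transitivity (avg n (fun s => P s + Q s)); last by rewrite avgD PQ; ring.
  apply: eq_avg => s _; rewrite /P /Q /ind; case: (leP L (walk s ^+ 2)) => //= h.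
    case: (ltgtP 0 (walk s)) => w0 /=; rewrite ?addr0 ?add0r//.
    by move: h; rewrite -w0 expr0n /= leNgt L0.
  by rewrite addr0.
apply: (@le_trans _ _ (avg n (fun s => avg n (fun t => P s * P t + Q s * Q t)))).
  have -> : avg n (fun s => avg n (fun t => P s * P t + Q s * Q t)) =
      avg n P * avg n P + avg n Q * avg n Q.
    by rewrite -!avg_indep -avgD; apply: eq_avg => s _; rewrite avgD.
  rewrite PQ -/p pP; lra.
rewrite avg_cat; apply: avg_le => s _; apply: avg_le => t _.
rewrite walk_cat /P /Q /ind.
case: (leP L (walk s ^+ 2)) => //= hs; last by rewrite !mul0r addr0 ler0n.
case: (leP L (walk t ^+ 2)) => //= ht; last by rewrite !mulr0 addr0 ler0n.
have key : 0 < walk s * walk t -> 4 * L <= (walk s + walk t) ^+ 2.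
  move=> h; suff : L <= walk s * walk t by nra.
  rewrite -(@ler_pXn2r _ 2) ?nnegrE ?(ltW h) ?(ltW L0)//.
  by rewrite exprMn [L ^+ 2]expr2 ler_pM// ltW.
have s0 : walk s != 0 by rewrite -sqrf_eq0; lra.
have t0 : walk t != 0 by rewrite -sqrf_eq0; lra.
case: (ltgtP 0 (walk s)) s0 key => // hs' _ key;
  case: (ltgtP 0 (walk t)) t0 key => // ht' _ key;
  rewrite ?mulr0 ?mul0r ?mulr1 ?addr0 ?add0r ?ler0n//= key//.
- by rewrite mulr_gt0.
- by rewrite nmulr_rgt0.
Qed.

(** Deviations by any multiple of the standard deviation have a probability
   bounded below uniformly in the length of the walk, once it is long enough. *)
Lemma walk_tail i : exists2 c : R, 0 < c <= 1 &
  forall j, (i <= j)%N ->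
  c <= avg (2 ^ j) (fun s => ind (2 ^+ i * 2 ^+ j / 4 <= walk s ^+ 2)).
Proof.
elim: i => [|i [c /andP[c0 c1] IH]].
  exists 16^-1; first by apply/andP; split; lra.
  move=> j _; rewrite expr0 mul1r.
  by have := @walk_tail0 (2 ^ j) (expn_gt0 _ _); rewrite natrX.
exists (c ^+ 2 / 2); first by apply/andP; split; nra.
move=> [|j] //; rewrite ltnS => /IH h.
rewrite expnS mul2n -addnn.
apply: le_trans; last first.
  have -> : 2 ^+ i.+1 * 2 ^+ j.+1 / 4 = 4 * (2 ^+ i * 2 ^+ j / 4) :> R.
    by rewrite !exprS; field.
  by apply: walk_tail_double; rewrite divr_ge0// mulr_ge0// exprn_ge0.
by move: h; set p := avg _ _ => h; nra.
Qed.

(** The number of times of [s], a path of length 2^j, that lie in no dyadic block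
   whose squared increment is at least [A] times its length. Blocks of length 1
   never count as exceptional, which loses nothing when 1 < A. *)
Fixpoint uncovered (A : R) j s : R :=
  if j is j'.+1 then
    if A * 2 ^+ j <= walk s ^+ 2 then 0
    else uncovered A j' (take (2 ^ j') s) + uncovered A j' (drop (2 ^ j') s)
  else 1.

Lemma uncovered_ge0 A j s : 0 <= uncovered A j s.
Proof. by elim: j s => [|j IH] s //=; case: ifP => // _; rewrite addr_ge0. Qed.

Lemma uncovered_good A j s : 1 < A -> size s = (2 ^ j)%N ->
  A * 2 ^+ j <= walk s ^+ 2 -> uncovered A j s = 0.
Proof.
move=> A1; case: j => [|j] ss /= h; last by rewrite h.
case: s ss h => [|b [|]]//= _; rewrite walk_cons /walk big_nil addr0 expr0 mulr1.
by rewrite /sgb; case: b; rewrite ?sqrrN expr1n leNgt A1.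
Qed.

(** An uncovered time of a block of length 2^(j+1) is an uncovered time of one of
   the halves; both the block and this half are then unexceptional, which forces
   the increment over the other half, independent of the first, not to be large. *)
Lemma avg_uncovered_step A j : 1 < A ->
  avg (2 ^ j.+1) (uncovered A j.+1) <=
  2 * (1 - avg (2 ^ j) (fun s => ind (6 * A * 2 ^+ j <= walk s ^+ 2))) *
  avg (2 ^ j) (uncovered A j).
Proof.
move=> A1; set p := avg _ (fun s => ind _).
pose q s : R := 1 - ind (6 * A * 2 ^+ j <= walk s ^+ 2).
have q01 s : 0 <= q s by rewrite /q /ind; case: (6 * A * _ <= _); rewrite /=; lra.
have qE : avg (2 ^ j) q = 1 - p.
  rewrite -[X in _ = X - _](avg_cst (2 ^ j)) /p -mulN1r -avgZ -avgD.
  by apply: eq_avg => s _; rewrite mulN1r.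
have -> : 2 * (1 - p) * avg (2 ^ j) (uncovered A j) =
    avg (2 ^ j) (fun s => avg (2 ^ j) (fun t => uncovered A j s * q t + q s * uncovered A j t)).
  transitivity (avg (2 ^ j) (uncovered A j) * avg (2 ^ j) q +
                avg (2 ^ j) q * avg (2 ^ j) (uncovered A j)); first by rewrite qE; ring.
  by rewrite -!avg_indep -avgD; apply: eq_avg => s _; rewrite avgD.
have -> : (2 ^ j.+1 = 2 ^ j + 2 ^ j)%N by rewrite expnS mul2n addnn.
rewrite avg_cat; apply: avg_le => s hs; apply: avg_le => t ht.
rewrite [uncovered A j.+1]/= -hs take_size_cat// drop_size_cat// walk_cat.
case: (leP (A * 2 ^+ j.+1)) => [_|parent].
  by rewrite addr_ge0// mulr_ge0// uncovered_ge0.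
(* From (a + b)^2 < 2A 2^j and a^2 < A 2^j follows b^2 < 6A 2^j. *)
have key u v : size u = (2 ^ j)%N -> (walk u + walk v) ^+ 2 < A * 2 ^+ j.+1 ->
    uncovered A j u <= uncovered A j u * q v.
  move=> hu huv; case: (leP (A * 2 ^+ j) (walk u ^+ 2)) => [child|child].
    by rewrite uncovered_good// mul0r.
  suff -> : q v = 1 by rewrite mulr1.
  rewrite /q /ind leNgt; suff -> : walk v ^+ 2 < 6 * A * 2 ^+ j by rewrite subr0.
  move: huv; rewrite [2 ^+ j.+1]exprS => huv.
  have := sqr_ge0 (walk v + 2 * walk u); nra.
rewrite lerD//; first exact: key.
by rewrite mulrC; apply: key => //; rewrite addrC.
Qed.

(** For long walks almost all times are covered by exceptional blocks. *)
Lemma avg_uncovered A (e : R) : 1 < A -> 0 < e ->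
  exists j, avg (2 ^ j) (uncovered A j) <= e * 2 ^+ j.
Proof.
move=> A1 e0.
(* 6A <= 2^i / 4, so that the lower bound of [walk_tail] applies. *)
have [i hi] : exists i, 24 * A <= 2 ^+ i.
  exists (Num.bound (24 * A)); apply: ltW.
  apply: lt_le_trans (archi_boundP _) _; first lra.
  by rewrite -natrX ler_nat ltnW// ltn_expl.
have [c /andP[c0 c1] hc] := walk_tail i.
have step j : (i <= j)%N ->
    avg (2 ^ j.+1) (uncovered A j.+1) <= 2 * (1 - c) * avg (2 ^ j) (uncovered A j).
  move=> ij; apply: le_trans (avg_uncovered_step j A1) _.
  rewrite ler_wpM2r ?avg_ge0// => [s _|]; first exact: uncovered_ge0.
  rewrite ler_pM2l// lerB//; apply: le_trans (hc _ ij) _.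
  apply: avg_le => s _; rewrite /ind ler_nat.
  case: (leP (2 ^+ i * 2 ^+ j / 4)) => //= h; suff -> : 6 * A * 2 ^+ j <= walk s ^+ 2 by [].
  apply: le_trans h.
  have : 0 < 2 ^+ j :> R by rewrite exprn_gt0.
  nra.
have geo k : avg (2 ^ (i + k)) (uncovered A (i + k)) <=
    (1 - c) ^+ k * (2 ^+ k * avg (2 ^ i) (uncovered A i)).
  elim: k => [|k IH]; first by rewrite addn0 !expr0 !mul1r.
  rewrite addnS; apply: le_trans (step _ (leq_addr _ _)) _.
  rewrite !exprS.
  have -> : (1 - c) * (1 - c) ^+ k * (2 * 2 ^+ k * avg (2 ^ i) (uncovered A i)) =
    2 * (1 - c) * ((1 - c) ^+ k * (2 ^+ k * avg (2 ^ i) (uncovered A i))) by ring.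
  by rewrite ler_wpM2l// mulr_ge0// subr_ge0.
(* Bernoulli's inequality, in the form (1 - c)^k <= 1 / (1 + k c). *)
have bern k : (1 - c) ^+ k * (1 + k%:R * c) <= 1.
  elim: k => [|k IH]; first by rewrite mul0r addr0 mulr1 expr0.
  apply: le_trans IH; rewrite exprS -[k.+1]addn1 natrD mulrAC mulrC.
  rewrite ler_wpM2l ?exprn_ge0 ?subr_ge0//.
  have : 0 <= k%:R :> R by []; nra.
set E := avg (2 ^ i) (uncovered A i) in geo.
have E0 : 0 <= E by apply: avg_ge0 => s _; exact: uncovered_ge0.
have d0 : 0 < e * 2 ^+ i * c by rewrite !mulr_gt0 ?exprn_gt0.
pose k := Num.bound (E / (e * 2 ^+ i * c)).
have hk : E <= e * 2 ^+ i * (1 + k%:R * c).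
  have : E / (e * 2 ^+ i * c) < k%:R by apply: archi_boundP; rewrite divr_ge0// ltW.
  rewrite ltr_pdivrMr// => h.
  have : 0 < e * 2 ^+ i by rewrite mulr_gt0 ?exprn_gt0.
  nra.
exists (i + k)%N; apply: le_trans (geo k) _.
have -> : e * 2 ^+ (i + k) = 2 ^+ k * (e * 2 ^+ i) by rewrite exprD; ring.
rewrite mulrCA ler_pM2l ?exprn_gt0//.
apply: le_trans (_ : (1 - c) ^+ k * (e * 2 ^+ i * (1 + k%:R * c)) <= _).
  by rewrite ler_wpM2l// exprn_ge0// subr_ge0.
rewrite mulrCA -[leRHS]mulr1 ler_wpM2l//.
by rewrite ltW// mulr_gt0 ?exprn_gt0.
Qed.

End Walk.

(** * Quadratic variation along chosen indices *)

Section Variation.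
Context {R : realType}.
Implicit Types (u w : nat -> R) (s t : seq bool).

(** [var_path u a b v]: some increasing sequence of indices from [a] to [b] has
   sum of squared increments of [u] equal to [v]. *)
Inductive var_path u (a : nat) : nat -> R -> Prop :=
| var_nil : var_path u a a 0
| var_step b c v : var_path u a b v -> (b < c)%N ->
    var_path u a c (v + (u c - u b) ^+ 2).

Lemma var_cat u a b c v v' :
  var_path u a b v -> var_path u b c v' -> var_path u a c (v + v').
Proof.
move=> uab; elim=> [|d e z _ IH de]; first by rewrite addr0.
by rewrite addrA; exact: var_step.
Qed.

Lemma var_one u a b : (a < b)%N -> var_path u a b ((u b - u a) ^+ 2).
Proof. by move=> ab; rewrite -[_ ^+ 2]add0r; apply: var_step => //; exact: var_nil. Qed.

Lemma var_path_le u a b v : var_path u a b v -> (a <= b)%N.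
Proof. by elim=> // c d w _ ac cd; rewrite (leq_trans ac)// ltnW. Qed.

Lemma var_shift u w (z : R) K N b v :
  (forall k, (k <= N)%N -> u (K + k)%N = z + w k) ->
  (b <= N)%N -> var_path w 0 b v -> var_path u K (K + b) v.
Proof.
move=> uw + H; elim: H => [|c d x _ IH cd] dN; first by rewrite addn0; exact: var_nil.
have cN : (c <= N)%N by rewrite (leq_trans _ dN)// ltnW.
have -> : w d - w c = u (K + d)%N - u (K + c)%N by rewrite !uw//; ring.
by apply: var_step; [exact: IH|rewrite ltn_add2l].
Qed.

Lemma var_congr u w N a b v : (forall k, (k <= N)%N -> u k = w k) ->
  (b <= N)%N -> var_path w a b v -> var_path u a b v.
Proof.
move=> uw + H; elim: H => [|c d x _ IH cd] dN; first exact: var_nil.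
have cN : (c <= N)%N by rewrite (leq_trans _ dN)// ltnW.
by rewrite -!uw//; apply: var_step => //; exact: IH.
Qed.

(** The end points of the maximal exceptional blocks, together with the uncovered
   times, realize a quadratic variation of [c ^+ 2 * A] for each covered time. *)
Lemma uncovered_gain A (c : R) j u a s : size s = (2 ^ j)%N ->
  (forall k, (k <= 2 ^ j)%N -> u (a + k)%N = u a + c * walk (take k s)) ->
  exists2 v, c ^+ 2 * (A * (2 ^+ j - uncovered A j s)) <= v &
             var_path u a (a + 2 ^ j) v.
Proof.
elim: j a s => [|j IH] a s ss us.
  exists ((u (a + 1)%N - u a) ^+ 2); last by apply: var_one; rewrite addn1.
  by rewrite /= expr0 subrr !mulr0 sqr_ge0.
rewrite [uncovered _ _ _]/=; case: (leP (A * 2 ^+ j.+1)) => big.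
  exists ((u (a + 2 ^ j.+1)%N - u a) ^+ 2).
    by rewrite us// -ss take_size addrAC subrr add0r exprMn subr0 ler_wpM2l ?sqr_ge0.
  by apply: var_one; rewrite -addn1 leq_add2l expn_gt0.
have e2 : (2 ^ j.+1 = 2 ^ j + 2 ^ j)%N by rewrite expnS mul2n addnn.
have [||v1 hv1 p1] := IH a (take (2 ^ j) s).
- by rewrite size_takel// ss e2 leq_addr.
- move=> k hk; rewrite take_takel// us// e2.
  exact: leq_trans hk (leq_addr _ _).
have [||v2 hv2 p2] := IH (a + 2 ^ j)%N (drop (2 ^ j) s).
- by rewrite size_drop ss e2 addnK.
- move=> k hk; rewrite -addnA us ?e2 ?leq_add2l// us ?e2 ?leq_addr//.
  by rewrite takeD walk_cat mulrDr addrA.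
exists (v1 + v2); last by rewrite e2 addnA; exact: var_cat p1 p2.
apply: (le_trans _ (lerD hv1 hv2)); rewrite [2 ^+ j.+1]exprS.
set x := uncovered _ _ _; set y := uncovered _ _ _.
by rewrite le_eqVlt; apply/orP; left; apply/eqP; ring.
Qed.

(** The walk frozen as soon as its absolute value exceeds [L]. *)
Definition stopped (L : R) s : R :=
  foldl (fun x b => if `|x| <= L then x + sgb b else x) 0 s.

Lemma stopped_rcons L s b : stopped L (rcons s b) =
  if `|stopped L s| <= L then stopped L s + sgb b else stopped L s.
Proof. by rewrite /stopped -cats1 foldl_cat. Qed.

Lemma stopped_bound L s : 0 <= L -> `|stopped L s| <= L + 1.
Proof.
move=> L0; elim/last_ind: s => [|s b IH].
  by rewrite normr0 addr_ge0.
rewrite stopped_rcons; case: ifP => // h.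
apply: le_trans (ler_normD _ _) _; rewrite lerD//.
by case: b; rewrite ?normrN normr1.
Qed.

Lemma stopped_mart L s :
  stopped L (rcons s true) + stopped L (rcons s false) = 2 * stopped L s.
Proof. by rewrite !stopped_rcons; case: ifP => _; rewrite /sgb; ring. Qed.

(** A path that is not frozen at its end was never frozen. *)
Lemma stopped_walk L s : `|stopped L s| <= L -> stopped L s = walk s.
Proof.
elim/last_ind: s => [|s b IH]; first by rewrite /walk big_nil.
rewrite stopped_rcons; case: ifP => [h _|->//].
by rewrite walk_rcons IH.
Qed.

Lemma stopped_take L s k : `|stopped L s| <= L -> `|stopped L (take k s)| <= L.
Proof.
move=> h; rewrite -(cat_take_drop k s) in h; move: h.
elim/last_ind: (drop k s) => [|t b IH]; first by rewrite cats0.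
by rewrite -rcons_cat stopped_rcons; case: ifP => // h _; exact: IH.
Qed.

Lemma avg_stopped2 L n : avg n (fun s => stopped L s ^+ 2) <= n%:R.
Proof.
elim: n => [|n IH]; first by rewrite /= expr0n.
rewrite avg_rcons -[n.+1]addn1 natrD.
apply: (le_trans _ (lerD IH (lexx (1 : R)))).
rewrite -[X in _ <= _ + X](avg_cst n) -avgD; apply: avg_le => s _.
by rewrite !stopped_rcons; case: ifP => _; rewrite /sgb; lra.
Qed.

(** Some choice of indices from [a] to [b] gives [u] a quadratic variation of at
   least 1. *)
Definition var_ge1 u a b : Prop := exists2 v, 1 <= v & var_path u a b v.

Lemma avg_markov n (f : seq bool -> R) (P : seq bool -> bool) c :
  (forall s, 0 <= f s) -> (forall s, size s = n -> P s -> c <= f s) ->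
  c * avg n (fun s => ind (P s)) <= avg n f.
Proof.
move=> f0 Pf; rewrite -avgZ; apply: avg_le => s sn.
by rewrite /ind; case: (boolP (P s)) => [/(Pf _ sn)|]; rewrite ?mulr1// mulr0.
Qed.

(** A walk with steps [c], stopped at level [c * L], can be uniformly small and yet
   have quadratic variation at least 1 with probability close to 1. *)
Lemma bounded_walk_large_variation (e : R) : 0 < e <= 1 -> exists (N : nat) (c L : R),
  [/\ (0 < N)%N, forall s, `|c * stopped L s| <= e &
   avg N (fun s => ind `[< ~ var_ge1 (fun k => c * stopped L (take k s)) 0 N >])
     <= e].
Proof.
move=> /andP[e0 e1].
have e0' : e != 0 by rewrite gt_eqF.
(* With c^2 = 2 / (A n) and L^2 = 2 n / e, half the times being covered yields a
   variation of c^2 A n / 2 = 1, freezing has probability at most n / L^2 = e / 2,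
   and the walk is bounded by c (L + 1) <= 2 c L = e for this A. *)
pose A := 16 / e ^+ 3.
have e3 : 0 < e ^+ 3 <= 1 by rewrite exprn_gt0//= exprn_ile1// ltW.
have A16 : 16 <= A by rewrite /A ler_pdivlMr; nra.
have A0 : 0 < A by lra.
have [||j hj] := @avg_uncovered R A (e / 4); [lra|lra|].
pose N := (2 ^ j)%N; pose n : R := 2 ^+ j.
have Nn : N%:R = n by rewrite /N natrX.
have n1 : 1 <= n by rewrite /n exprn_ege1// ler1n.
have n0 : 0 < n by lra.
have n0' : n != 0 by rewrite gt_eqF.
pose L := Num.sqrt (2 * n / e); pose c := Num.sqrt (2 / (A * n)).
have An0 : 0 < A * n by rewrite mulr_gt0.
have L2 : L ^+ 2 = 2 * n / e by rewrite sqr_sqrtr// divr_ge0// ?mulr_ge0// ltW.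
have c2 : c ^+ 2 = 2 / (A * n) by rewrite sqr_sqrtr// divr_ge0// ltW.
have c0 : 0 <= c by exact: sqrtr_ge0.
have L0 : 0 <= L by exact: sqrtr_ge0.
have L1 : 1 <= L.
  rewrite -(@ler_pXn2r _ 2) ?nnegrE// expr1n L2 ler_pdivlMr//; nra.
have ce : c * (L + 1) <= e.
  apply: (@le_trans _ _ (c * (2 * L))); first by rewrite ler_wpM2l//; lra.
  rewrite -(@ler_pXn2r _ 2) ?nnegrE ?(ltW e0)// ?mulr_ge0//.
  have -> : (c * (2 * L)) ^+ 2 = 4 * (c ^+ 2 * L ^+ 2) by ring.
  rewrite c2 L2 le_eqVlt; apply/orP; left; apply/eqP; rewrite /A; field.
  by rewrite e0' n0'.
exists N, c, L; split; first by rewrite expn_gt0.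
  move=> s; rewrite normrM (ger0_norm c0); apply: le_trans ce.
  by rewrite ler_wpM2l// stopped_bound.
have h1 : avg N (fun s => ind (n / 2 <= uncovered A j s)) <= e / 2.
  have h : n / 2 * avg N (fun s => ind (n / 2 <= uncovered A j s)) <= avg N (uncovered A j).
    by apply: avg_markov => // s; exact: uncovered_ge0.
  have := le_trans h hj; rewrite -/n.
  by set p := avg _ _; nra.
have h2 : avg N (fun s => ind (L < `|stopped L s|)) <= e / 2.
  have h : L ^+ 2 * avg N (fun s => ind (L < `|stopped L s|)) <=
      avg N (fun s => stopped L s ^+ 2).
    apply: avg_markov => [s|s _ h]; first exact: sqr_ge0.
    by rewrite -[leRHS]real_normK ?num_real// ler_pXn2r ?nnegrE// ltW.
  have := le_trans h (avg_stopped2 _ _); rewrite Nn L2.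
  set p := avg _ _; rewrite mulrAC ler_pdivrMr//; nra.
apply: le_trans (_ : e / 2 + e / 2 <= _); last by lra.
apply: le_trans (lerD h1 h2); rewrite -avgD; apply: avg_le => s ss.
rewrite /ind; case: (leP (n / 2)) => [_|hu].
  by rewrite -natrD ler_nat; case: asboolP.
case: (ltP L) => [_|hs]; first by rewrite -natrD ler_nat; case: asboolP.
rewrite asboolF ?addr0//; apply.
have ws k : stopped L (take k s) = walk (take k s).
  by apply: stopped_walk; exact: stopped_take.
have [|v hv pv] := @uncovered_gain A c j (fun k => c * stopped L (take k s)) 0 s ss.
  by move=> k _; rewrite add0n take0 mulr0 add0r ws.
exists v => //; apply: le_trans hv; rewrite c2.
have e1' : 2 / (A * n) * (A * (n / 2)) = 1 by field; rewrite n0' gt_eqF.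
rewrite -{1}e1'; move: hu; rewrite -/n => hu.
by rewrite ler_wpM2l ?divr_ge0 ?(ltW An0)// ler_pM2l//; lra.
Qed.
End Variation.

(** * A bounded martingale with infinite quadratic variation *)

Section Concatenation.
Context {R : realType}.
Implicit Types s t : seq bool.

(** [F] is a martingale in the bits of its argument; its oscillation on the block of
   times from [K i] to [K i.+1] is at most 2^-i, but on this block the quadratic
   variation is at least 1 outside a set of bit sequences of density at most
   2^-i. *)
Theorem martingale_infinite_variation : exists (F : seq bool -> R) (K : nat -> nat),
  [/\ F [::] = 0,
      forall s, F (rcons s true) + F (rcons s false) = 2 * F s,
      K 0%N = 0%N /\ forall i, (K i < K i.+1)%N,
      forall i s, (K i <= size s <= K i.+1)%N ->
        `|F s - F (take (K i) s)| <= 2^-1 ^+ i &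
      forall i, @avg R (K i.+1) (fun s =>
        ind `[< ~ var_ge1 (fun k => F (take k s)) (K i) (K i.+1) >]) <= (2^-1 ^+ i : R)].
Proof.
have H i : exists p : nat * R * R,
  [/\ (0 < p.1.1)%N, forall s, `|p.1.2 * stopped p.2 s| <= 2^-1 ^+ i &
   @avg R p.1.1 (fun s => ind `[< ~ var_ge1
     (fun k => p.1.2 * stopped p.2 (take k s)) 0 p.1.1 >]) <= 2^-1 ^+ i].
  have e01 : 0 < (2^-1 : R) ^+ i <= 1.
    by rewrite exprn_gt0 ?invr_gt0// exprn_ile1// ?invr_ge0// invf_le1// ler1n.
  by have [N [c [L ?]]] := bounded_walk_large_variation e01; exists (N, c, L).
have [p Hp] := choice H.
pose N i := (p i).1.1; pose c i := (p i).1.2; pose L i := (p i).2.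
have N0 i : (0 < N i)%N by have [] := Hp i.
pose K i := (\sum_(j < i) N j)%N.
have KS i : K i.+1 = (K i + N i)%N by rewrite /K big_ord_recr.
have Klt i : (K i < K i.+1)%N by rewrite KS -addn1 leq_add2l.
have Kmono : {homo K : i j / (i <= j)%N} by apply: homo_leq leq_trans _ => // i; exact: ltnW.
have Kge i : (i <= K i)%N by elim: i => // i IH; exact: leq_ltn_trans IH (Klt i).
(* The i-th walk runs on the bits of index K i, ..., K i.+1 - 1. *)
pose term i s := c i * stopped (L i) (take (N i) (drop (K i) s)).
(* Since i <= K i, walks of index at least the length of s have not started. *)
pose F s := \sum_(i < size s) term i s.
have term0 i s : (size s <= K i)%N -> term i s = 0.
  by move=> h; rewrite /term drop_oversize// /stopped /= mulr0.
have FE n s : (size s <= n)%N -> F s = \sum_(i < n) term i s.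
  move=> sn; rewrite -(subnKC sn) big_split_ord/= [X in _ + X]big1 ?addr0// => i _.
  by rewrite term0//= (leq_trans _ (Kge _))// leq_addr.
have mart s : F (rcons s true) + F (rcons s false) = 2 * F s.
  rewrite !(FE (size s).+1) ?size_rcons// -big_split mulr_sumr; apply: eq_bigr => i _.
  rewrite /term/= -mulrDr mulrCA; congr (_ * _).
  case: (leqP (K i) (size s)) => h; last first.
    by rewrite !drop_oversize ?size_rcons ?(ltnW h)// /stopped/= addr0 mulr0.
  rewrite !drop_rcons//; set t := drop _ _; case: (leqP (N i) (size t)) => h'.
    by rewrite -!cats1 !takel_cat//; ring.
  by rewrite !take_oversize ?size_rcons// ?(ltnW h')// stopped_mart.
have Fblock i s : (K i <= size s <= K i.+1)%N ->
    F s = F (take (K i) s) + c i * stopped (L i) (drop (K i) s).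
  move=> /andP[h1 h2].
  rewrite !(FE (size s + i).+1) ?size_take_min; last 2 first.
  - by rewrite (leq_trans (geq_minr _ _))// -addnS leq_addr.
  - by rewrite -addnS leq_addr.
  have ilt : (i < (size s + i).+1)%N by rewrite ltnS leq_addl.
  rewrite (bigD1 (Ordinal ilt))//= [in RHS](bigD1 (Ordinal ilt))//=.
  rewrite [term i (take _ _)]term0 ?size_take_min ?geq_minl// add0r addrC.
  congr (_ + _); last first.
    by rewrite /term take_oversize// size_drop leq_subLR -KS.
  apply: eq_bigr => -[j jlt] /=; rewrite -val_eqE/= => ji.
  case: (ltngtP j i) ji => // ji _.
    rewrite /term !take_drop take_takel// addnC -KS; exact: Kmono.
  have le : (size s <= K j)%N by rewrite (leq_trans h2)// Kmono.
  by rewrite !term0// size_take_min (leq_trans (geq_minr _ _)).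
exists F, K; split => //.
- by rewrite /F big_ord0.
- by split => //; rewrite /K big_ord0.
- move=> i s h; rewrite (Fblock _ _ h) addrAC subrr add0r.
  have [_ hb _] := Hp i; exact: hb.
- move=> i; rewrite KS avg_cat -[leRHS](avg_cst (K i)); apply: avg_le => s ss.
  have [_ _ hb] := Hp i; apply: (le_trans _ hb); apply: avg_le => t tt.
  rewrite /ind ler_nat; case: asboolP => // nG; case: asboolP => //= /contrapT[v v1 pv].
  exfalso; apply: nG; exists v => //.
  apply: (@var_shift _ _ _ (F s) (K i) (N i)) pv => // k kN.
  have sz : size (take (K i + k) (s ++ t)) = (K i + k)%N.
    by rewrite size_takel// size_cat ss tt leq_add2l.
  rewrite (Fblock i) ?sz ?KS ?leq_addr ?leq_add2l//.
  by rewrite take_takel ?leq_addr// -ss take_size_cat// takeD take_size_cat//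
    drop_size_cat// drop_size_cat.
Qed.
End Concatenation.

(** * Real square integrable functions on the unit interval *)

Section L2.
Context {R : realType}.
Notation mu := (@lebesgue_measure R).
Implicit Types u v w : R -> R.

Lemma measurable_T01 : measurable (@T01 R).
Proof. exact: measurable_itv. Qed.
Hint Resolve measurable_T01 : core.

Lemma mu_T01 : mu T01 = 1%E.
Proof. by rewrite lebesgue_measure_itv/= lte_fin ltr01 oppr0 adde0. Qed.

(** Integrability, square integrability and the inner product on [0, 1]. *)
Definition integ u := mu.-integrable T01 (EFin \o u).
Definition L2 u := measurable_fun T01 u /\ integ (fun x => u x ^+ 2).
Definition ip u v : R := \int[mu]_(x in T01) (u x * v x).

Lemma integ_bounded u (C : R) : measurable_fun T01 u ->
  (forall x, T01 x -> `|u x| <= C) -> integ u.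
Proof.
move=> mu_ uC; apply: measurable_bounded_integrable => //.
  by apply: (eq_ind_r (fun z => (z < +oo)%E) (ltry 1) mu_T01).
exists C; split; first exact: num_real.
by move=> M CM x /uC /le_trans; apply; exact: ltW.
Qed.

Lemma integD u v : integ u -> integ v -> integ (fun x => u x + v x).
Proof.
move=> iu iv; rewrite /integ.
have -> : EFin \o (fun x => u x + v x) = ((EFin \o u) \+ (EFin \o v))%E.
  by apply/funext => x.
exact: integrableD.
Qed.

Lemma integZ c u : integ u -> integ (fun x => c * u x).
Proof.
move=> iu; rewrite /integ.
have -> : EFin \o (fun x => c * u x) = (fun x => c%:E * (EFin \o u) x)%E.
  by apply/funext => x.
exact: integrableZl.
Qed.

Lemma integ_le u v : measurable_fun T01 u -> integ v ->
  (forall x, T01 x -> `|u x| <= v x) -> integ u.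
Proof.
move=> mu_ iv uv; apply: le_integrable iv => //.
  exact/measurable_EFinP.
by move=> x xT /=; rewrite lee_fin (le_trans (uv _ xT))// ler_norm.
Qed.

Lemma integ_sum n (u : nat -> R -> R) : (forall i, integ (u i)) ->
  integ (fun x => \sum_(i < n) u i x) /\
  \int[mu]_(x in T01) (\sum_(i < n) u i x) = \sum_(i < n) \int[mu]_(x in T01) u i x.
Proof.
move=> iu; elim: n => [|n [IH1 IH2]].
  rewrite big_ord0; under eq_Rintegral do rewrite big_ord0.
  split; last by rewrite Rintegral_cst// mul0r.
  apply: (@integ_bounded _ 0) => [|x _]; last by rewrite big_ord0 normr0.
  by under eq_fun do rewrite big_ord0; exact: measurable_cst.
have e : (fun x => \sum_(i < n.+1) u i x) = (fun x => \sum_(i < n) u i x + u n x).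
  by apply/funext => x; rewrite big_ord_recr.
rewrite e; split; first exact: integD.
by rewrite (RintegralD _ IH1 (iu n))//= IH2 big_ord_recr.
Qed.

Lemma L2_integM u v : L2 u -> L2 v -> integ (fun x => u x * v x).
Proof.
move=> [mu_ iu] [mv iv]; apply: integ_le (integD iu iv) _.
  exact: measurable_funM.
move=> x _; have := sqr_ge0 (u x - v x); have := sqr_ge0 (u x + v x).
by rewrite ler_norml; move=> h1 h2; apply/andP; split; nra.
Qed.

Lemma L2_bounded u (C : R) : measurable_fun T01 u ->
  (forall x, T01 x -> `|u x| <= C) -> L2 u.
Proof.
move=> mu_ uC; split=> //; apply: (@integ_bounded _ (C ^+ 2)) => [|x xT].
  exact: measurable_funX.
by rewrite normrX ler_pXn2r ?nnegrE ?uC// (le_trans _ (uC _ xT)).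
Qed.

Lemma L2D u v : L2 u -> L2 v -> L2 (fun x => u x + v x).
Proof.
move=> hu hv; have iuv := L2_integM hu hv; move: hu hv => [mu_ iu] [mv iv].
split; first exact: measurable_funD.
have -> : (fun x => (u x + v x) ^+ 2) =
    (fun x => (u x ^+ 2 + v x ^+ 2) + 2 * (u x * v x)).
  by apply/funext => x; ring.
by apply: integD; [exact: integD|exact: integZ].
Qed.

Lemma L2Z c u : L2 u -> L2 (fun x => c * u x).
Proof.
move=> [mu_ iu]; split; first exact: measurable_funM.
have -> : (fun x => (c * u x) ^+ 2) = (fun x => c ^+ 2 * u x ^+ 2).
  by apply/funext => x; rewrite exprMn.
exact: integZ.
Qed.

Lemma L2B u v : L2 u -> L2 v -> L2 (fun x => u x - v x).
Proof.
move=> hu hv; have := L2D hu (L2Z (-1) hv).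
by under [X in L2 X]eq_fun do rewrite mulN1r.
Qed.

Lemma L2_cst c : L2 (cst c).
Proof. by apply: (@L2_bounded _ `|c|). Qed.

Lemma L2_integ u : L2 u -> integ u.
Proof.
move=> hu; have := L2_integM hu (L2_cst 1).
by under [X in integ X]eq_fun do rewrite /= mulr1.
Qed.

Lemma L2_mulb u v (C : R) : L2 u -> measurable_fun T01 v ->
  (forall x, T01 x -> `|v x| <= C) -> L2 (fun x => v x * u x).
Proof.
move=> [mu_ iu] mv vC; split; first exact: measurable_funM.
apply: integ_le (integZ (C ^+ 2) iu) _.
  by apply: measurable_funX; exact: measurable_funM.
move=> x xT; rewrite normrX normrM exprMn.
rewrite [`|u x| ^+ 2]real_normK ?num_real// ler_wpM2r ?sqr_ge0//.
by rewrite ler_pXn2r ?nnegrE ?vC// (le_trans _ (vC _ xT)).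
Qed.

Lemma ipC u v : ip u v = ip v u.
Proof. by rewrite /ip; under eq_Rintegral do rewrite mulrC. Qed.

Lemma ipDl u v w : L2 u -> L2 v -> L2 w ->
  ip (fun x => u x + v x) w = ip u w + ip v w.
Proof.
move=> hu hv hw; rewrite /ip -(RintegralD _ (L2_integM hu hw) (L2_integM hv hw))//.
by apply: eq_Rintegral => x _; rewrite mulrDl.
Qed.

Lemma ipZl c u v : L2 u -> L2 v -> ip (fun x => c * u x) v = c * ip u v.
Proof.
move=> hu hv; rewrite /ip -(RintegralZl _ _ (L2_integM hu hv))//.
by apply: eq_Rintegral => x _; rewrite mulrA.
Qed.

Lemma ip_ge0 u : 0 <= ip u u.
Proof. by apply: Rintegral_ge0 => x _; rewrite -expr2 sqr_ge0. Qed.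

Lemma ip_bound u v (C : R) : measurable_fun T01 u ->
  (forall x, T01 x -> `|u x| <= C) -> L2 v ->
  `|ip u v| <= C * \int[mu]_(x in T01) `|v x|.
Proof.
move=> mu_ uC hv.
have hu := L2_bounded mu_ uC.
have iv : integ (fun x => `|v x|).
  by apply: integrable_norm; exact: L2_integ.
rewrite /ip; apply: le_trans (le_normr_Rintegral _ (L2_integM hu hv)) _ => //.
rewrite -(RintegralZl _ _ iv)//; apply: le_Rintegral => //.
- by apply: integrable_norm; exact: L2_integM.
- exact: integZ.
- by move=> x xT; rewrite normrM ler_wpM2r ?uC.
Qed.

End L2.

#[local] Hint Extern 0 (measurable T01) => exact: measurable_T01 : core.
(** * Binary digits as independent fair bits *)

Section Dyadic.
Context {R : realType}.
Notation mu := (@lebesgue_measure R).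
Implicit Types (x : R) (n i : nat).

(** The index of the dyadic interval of length 2^-n that contains [x >= 0]. *)
Definition cell n x : nat := Num.truncn (2 ^+ n * x).
(** The [n]-th binary digit of [x] in [0, 1); positions count from 1, the digit in
   position 0 being the parity of the integer part. *)
Definition bit n x : bool := odd (cell n x).
(** The digits in the positions listed in [ns]. *)
Definition bits (ns : seq nat) x : seq bool := [seq bit n x | n <- ns].

Let I n i : set R := `[i%:R / 2 ^+ n, i.+1%:R / 2 ^+ n[.

Let mI n i : measurable (I n i). Proof. exact: measurable_itv. Qed.

Let pow2 n : 0 < 2 ^+ n :> R. Proof. by rewrite exprn_gt0. Qed.

Lemma cell_eq n i x : 0 <= x -> (cell n x = i) <-> I n i x.
Proof.
move=> x0; rewrite /I/= in_itv/= ler_pdivrMr// ltr_pdivlMr// ![x * _]mulrC.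
rewrite -truncn_eq ?mulr_ge0 ?(ltW (pow2 n))//.
by rewrite /cell; split => /eqP.
Qed.

Lemma cell_half n x : 0 <= x -> cell n x = (cell n.+1 x)./2.
Proof.
move=> x0; apply/cell_eq => //; rewrite /I/= in_itv/= ler_pdivrMr// ltr_pdivlMr//.
have /andP[] := @truncn_itv _ (2 ^+ n.+1 * x) (mulr_ge0 (ltW (pow2 _)) x0).
rewrite -/(cell n.+1 x); set c := cell _ _.
have hc : c%:R = (odd c)%:R + 2 * (c./2)%:R :> R.
  by rewrite -{1}[c]odd_double_half natrD -muln2 natrM [_ * 2]mulrC.
rewrite -[c.+1]addn1 -[(c./2).+1]addn1 !natrD hc exprS => h1 h2.
have h3 : (odd c)%:R <= 1 :> R by case: odd.
have h4 : 0 <= (odd c)%:R :> R by [].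
by apply/andP; split; lra.
Qed.

Lemma cell_lt n x : T01 x -> (cell n x < (2 ^ n).+1)%N.
Proof.
rewrite /T01/= in_itv/= => /andP[x0 x1].
rewrite ltnS -(ler_nat R) natrX.
have /andP[+ _] := @truncn_itv _ (2 ^+ n * x) (mulr_ge0 (ltW (pow2 _)) x0).
by move=> /le_trans; apply; rewrite ler_piMr// ltW.
Qed.

(** The range 2^n + 1 includes the cell of the point 1, a null set. *)
Lemma fun_cellE (H : nat -> R) n x : T01 x ->
  H (cell n x) = \sum_(i < (2 ^ n).+1) H i * \1_(I n i) x.
Proof.
move=> xT; have x0 : 0 <= x by move: xT; rewrite /T01/= in_itv/= => /andP[].
rewrite (bigD1 (Ordinal (cell_lt n xT)))//= big1 ?addr0 => [|[i ilt]].
  by rewrite indicE mem_set ?mulr1//; apply/cell_eq.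
rewrite -val_eqE/= => ni; rewrite indicE memNset ?mulr0// => /(cell_eq _ _ x0) e.
by rewrite e eqxx in ni.
Qed.

Lemma measurable_cell (H : nat -> R) n :
  measurable_fun (@T01 R) (fun x => H (cell n x)).
Proof.
apply: (eq_measurable_fun (fun x => \sum_(i < (2 ^ n).+1) H i * \1_(I n i) x)).
  by move=> x /set_mem xT; rewrite -fun_cellE.
by apply: measurable_sum => i; apply: measurable_funM.
Qed.

Let int_I n i : (i < (2 ^ n).+1)%N ->
  \int[mu]_(x in T01) \1_(I n i) x = (i < 2 ^ n)%:R / 2 ^+ n.
Proof.
move=> ilt; transitivity (fine (mu (I n i `&` T01))).
  by congr fine; exact: (integral_indic mu measurable_T01 (mI n i)).
move: ilt; rewrite ltnS leq_eqVlt => /predU1P[->|ilt]; last first.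
  rewrite ilt setIidl.
    rewrite /I lebesgue_measure_itv/= lte_fin ltr_pM2r ?invr_gt0// ltr_nat ltnSn/=.
    by rewrite -mulrBl -natrB// subSnn.
  move=> x; rewrite /I/T01/= !in_itv/= => /andP[h1 h2]; apply/andP; split.
    by rewrite (le_trans _ h1)// divr_ge0// ltW.
  by rewrite ltW// (lt_le_trans h2)// ler_pdivrMr// mul1r -natrX ler_nat.
rewrite ltnn (_ : _ `&` _ = [set 1]) ?lebesgue_measure_set1/= ?mul0r//.
apply/seteqP; split=> x; rewrite /I/T01/= !in_itv/= natrX divff ?gt_eqF//.
  by move=> [/andP[h1 _] /andP[_ h2]]; apply/eqP; rewrite eq_le h1 h2.
by move=> ->; rewrite lexx ler01 ltr_pdivlMr// mul1r -natrX ltr_nat ltnSn.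
Qed.

Lemma int_cell (H : nat -> R) n :
  \int[mu]_(x in T01) H (cell n x) = (\sum_(i < 2 ^ n) H i) / 2 ^+ n.
Proof.
transitivity (\int[mu]_(x in T01) (\sum_(i < (2 ^ n).+1) H i * \1_(I n i) x)).
  by apply: eq_Rintegral => x /set_mem xT; exact: fun_cellE.
have iI i : integ (\1_(I n i) : R -> R).
  apply: (@integ_bounded _ _ 1) => [|x _].
    exact: measurable_indic.
  by rewrite indicE; case: (_ \in _); rewrite ?normr1 ?normr0.
have [_ ->] := @integ_sum _ (2 ^ n).+1 (fun i x => H i * \1_(I n i) x)
  (fun i => integZ (H i) (iI i)).
have e i : (i < (2 ^ n).+1)%N ->
    \int[mu]_(x in T01) (H i * \1_(I n i) x) = H i * ((i < 2 ^ n)%:R / 2 ^+ n).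
  by move=> /int_I <-; rewrite (RintegralZl _ _ (iI i)).
rewrite mulr_suml big_ord_recr/= e// ltnn mul0r mulr0 addr0.
apply: eq_bigr => i _; rewrite e ?ltn_ord ?mul1r//.
by rewrite ltnS ltnW.
Qed.

Lemma cell_shift n k x : 0 <= x -> cell n x = iter k half (cell (n + k) x).
Proof.
by move=> x0; elim: k n => [|k IH] n; rewrite ?addn0// (cell_half _ x0) IH addSnnS.
Qed.

(** The digits in positions at most [n], read off the index [c] of the cell of rank
   [n]. *)
Definition bits_of n (ns : seq nat) (c : nat) : seq bool :=
  [seq odd (iter (n - m) half c) | m <- ns].

Lemma bitsE n ns x : T01 x -> all (fun m => m <= n)%N ns ->
  bits ns x = bits_of n ns (cell n x).
Proof.
move=> xT /allP h; apply/eq_in_map => m /h mn.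
rewrite /bit (@cell_shift m (n - m)) ?subnKC//.
by move: xT; rewrite /T01/= in_itv/= => /andP[].
Qed.

Lemma measurable_bits (H : seq bool -> R) ns :
  measurable_fun (@T01 R) (fun x => H (bits ns x)).
Proof.
pose n := \max_(m <- ns) m.
apply: (eq_measurable_fun (fun x => H (bits_of n ns (cell n x)))).
  move=> x /set_mem xT; rewrite (@bitsE n)//.
  by apply/allP => m mns; exact: leq_bigmax_seq.
exact: (measurable_cell (fun c => H (bits_of n ns c))).
Qed.

Lemma sum_half (H : nat -> R) n :
  \sum_(i < 2 ^ n.+1) H i = \sum_(i < 2 ^ n) (H i.*2 + H i.*2.+1).
Proof.
rewrite expnS mul2n; elim: (2 ^ n)%N => [|m IH]; first by rewrite !big_ord0.
by rewrite doubleS !big_ord_recr/= IH addrA.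
Qed.

Lemma int_bits_rcons (H : seq bool -> R) ns n : all (fun m => m <= n)%N ns ->
  \int[mu]_(x in T01) H (bits (rcons ns n.+1) x) =
  \int[mu]_(x in T01)
     ((H (rcons (bits ns x) true) + H (rcons (bits ns x) false)) / 2).
Proof.
move=> hns.
pose G1 c := H (rcons (bits_of n ns c./2) (odd c)).
pose G2 c := (H (rcons (bits_of n ns c) true) +
              H (rcons (bits_of n ns c) false)) / 2.
transitivity (\int[mu]_(x in T01) G1 (cell n.+1 x)).
  apply: eq_Rintegral => x /set_mem xT; rewrite /bits map_rcons -/(bits ns x).
  rewrite (bitsE xT hns) (@cell_half n)//.
  by move: xT; rewrite /T01/= in_itv/= => /andP[].
transitivity (\int[mu]_(x in T01) G2 (cell n x)); last first.
  by apply: eq_Rintegral => x /set_mem xT; rewrite (bitsE xT hns).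
rewrite !int_cell sum_half exprS invfM mulrA; congr (_ / _).
rewrite mulr_suml; apply: eq_bigr => i _.
by rewrite /G1 /G2 /= uphalf_double doubleK odd_double/= addrC.
Qed.

(** Digits in distinct positive positions have the law of independent fair bits. *)
Lemma int_bits (H : seq bool -> R) ns : sorted ltn (0%N :: ns) ->
  \int[mu]_(x in T01) H (bits ns x) = avg (size ns) H.
Proof.
elim/last_ind: ns H => [|ns n IH] H.
  move=> _; rewrite /bits/= Rintegral_cst// -[RHS]mulr1; congr (_ * _).
  exact: (congr1 fine mu_T01).
rewrite size_rcons avg_rcons /= rcons_path => /andP[pns lns].
have hns : all (fun m => m < n)%N ns.
  have : sorted ltn (rcons (0%N :: ns) n) by rewrite /= rcons_path pns.
  rewrite (sorted_pairwise ltn_trans) pairwise_rcons => /andP[/= + _].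
  by case/andP.
case: n lns hns => // n _ hns.
rewrite int_bits_rcons//.
exact: (IH (fun s => (H (rcons s true) + H (rcons s false)) / 2) pns).
Qed.
End Dyadic.

(** * Rademacher functions and Bessel's inequality *)

Section Rademacher.
Context {R : realType}.
Notation mu := (@lebesgue_measure R).
Implicit Types u v w : R -> R.

(** The sign +1 or -1 coded by the [n]-th digit; these functions are orthonormal for [n > 0]. *)
Definition rademacher n (x : R) : R := sgb (bit n x).

Lemma normr_sgb b : `|sgb b| = 1 :> R.
Proof. by case: b; rewrite /sgb ?normrN normr1. Qed.

Lemma measurable_rademacher n : measurable_fun (@T01 R) (rademacher n).
Proof. exact: (measurable_bits (fun s => sgb (head true s)) [:: n]). Qed.

Lemma L2_rademacher n : L2 (rademacher n).
Proof.
apply: (@L2_bounded _ _ 1) => [|x _]; first exact: measurable_rademacher.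
by rewrite /rademacher normr_sgb.
Qed.

Lemma ip_rademacher m n : ip (rademacher m.+1) (rademacher n.+1) = (m == n)%:R.
Proof.
wlog mn : m n / (m <= n)%N => [h|].
  case: (leqP m n) => [|/ltnW] mn; first exact: h.
  by rewrite ipC h// eq_sym.
move: mn; rewrite leq_eqVlt => /predU1P[->|mn].
  rewrite eqxx /ip -[RHS](int_bits (fun=> 1) (ns := [::]))//.
  apply: eq_Rintegral => x _; rewrite /rademacher /sgb; case: bit; ring.
rewrite ltn_eqF//; pose H s : R := sgb (nth true s 0) * sgb (nth true s 1).
transitivity (\int[mu]_(x in T01) H (bits [:: m.+1; n.+1] x)); first by [].
by rewrite int_bits/= ?andbT// /H/= /sgb; field.
Qed.

Lemma bessel u n0 N : L2 u ->
  \sum_(n < N) ip u (rademacher (n0 + n).+1) ^+ 2 <= ip u u.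
Proof.
move=> hu; pose c n := ip u (rademacher (n0 + n).+1).
(* w is the remainder of u after removal of its first N components. *)
suff [w [hw ww _]] : exists w, [/\ L2 w,
    ip w w = ip u u - \sum_(n < N) c n ^+ 2 &
    forall m, (N <= m)%N -> ip w (rademacher (n0 + m).+1) = c m].
  by rewrite -subr_ge0 -ww ip_ge0.
elim: N => [|N [w [hw ww wc]]].
  by exists u; split => //; rewrite big_ord0 subr0.
have hr n : L2 (rademacher n) by exact: L2_rademacher.
have hr' k n : L2 (fun x => k * rademacher n x) by apply: L2Z.
have key v : L2 v -> ip (fun x => w x + - c N * rademacher (n0 + N).+1 x) v =
    ip w v - c N * ip (rademacher (n0 + N).+1) v.
  by move=> hv; rewrite ipDl// ipZl// mulNr.
exists (fun x => w x + - c N * rademacher (n0 + N).+1 x); split.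
- exact: L2D.
- rewrite key; last exact: L2D.
  rewrite ![ip _ (fun x => w x + _)]ipC !key// ip_rademacher eqxx.
  rewrite [ip (rademacher _) w]ipC wc// ww big_ord_recr/=; ring.
- move=> m Nm; rewrite key// wc ?(ltnW Nm)// ip_rademacher eqn_add2l ltn_eqF// mulr0 subr0//.
Qed.

(** Finitely many square integrable functions have simultaneously small
   coefficients with respect to some Rademacher function of large index. *)
Lemma small_coefs p (u : nat -> R -> R) (e : R) n0 :
  (forall j, L2 (u j)) -> 0 < e ->
  exists2 n, (n0 <= n)%N & forall j, (j < p)%N -> `|ip (u j) (rademacher n.+1)| <= e.
Proof.
move=> hu e0; apply: contrapT => no.
have big n : (n0 <= n)%N -> e ^+ 2 <= \sum_(j < p) ip (u j) (rademacher n.+1) ^+ 2.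
  move=> n0n; have [j [jp hj]] : exists j, (j < p)%N /\ e < `|ip (u j) (rademacher n.+1)|.
    apply: contrapT => h; apply: no; exists n => // j jp.
    by rewrite leNgt; apply/negP => h'; apply: h; exists j.
  rewrite (bigD1 (Ordinal jp))//= -[leLHS]addr0 lerD//.
    by rewrite -[leRHS]real_normK ?num_real// ler_pXn2r ?nnegrE// ltW.
  by apply: sumr_ge0 => i _; exact: sqr_ge0.
pose B := \sum_(j < p) ip (u j) (u j).
have B0 : 0 <= B by apply: sumr_ge0 => j _; exact: ip_ge0.
have e20 : 0 < e ^+ 2 by rewrite exprn_gt0.
pose N := Num.bound (B / e ^+ 2).
(* Otherwise Bessel's inequality fails for a large number N of Rademacher
   functions. *)
have NB : N%:R * e ^+ 2 <= B.
  have -> : N%:R * e ^+ 2 = \sum_(n < N) e ^+ 2.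
    by rewrite sumr_const card_ord mulr_natl.
  apply: (@le_trans _ _ (\sum_(n < N) \sum_(j < p) ip (u j) (rademacher (n0 + n).+1) ^+ 2)).
    by apply: ler_sum => n _; rewrite big// leq_addr.
  by rewrite exchange_big/=; apply: ler_sum => j _; exact: bessel.
have : B / e ^+ 2 < N%:R by apply: archi_boundP; rewrite divr_ge0// ltW.
by rewrite ltr_pdivrMr// ltNge NB.
Qed.
End Rademacher.

(** * Complex square integrable functions *)

Section ComplexL2.
Context {R : realType}.
Notation mu := (@lebesgue_measure R).
Notation Re := (@complex.Re R).
Notation Im := (@complex.Im R).
Implicit Types f g h : R -> R[i].

Lemma ReD (z w : R[i]) : Re (z + w) = Re z + Re w.
Proof. by case: z; case: w. Qed.
Lemma ImD (z w : R[i]) : Im (z + w) = Im z + Im w.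
Proof. by case: z; case: w. Qed.
Lemma ReM (z w : R[i]) : Re (z * w) = Re z * Re w - Im z * Im w.
Proof. by case: z; case: w. Qed.
Lemma ImM (z w : R[i]) : Im (z * w) = Re z * Im w + Im z * Re w.
Proof. by case: z; case: w. Qed.
Lemma Re_conj (z : R[i]) : Re z^* = Re z.
Proof. by case: z. Qed.
Lemma Im_conj (z : R[i]) : Im z^* = - Im z.
Proof. by case: z. Qed.
Lemma complex_eq (z w : R[i]) : Re z = Re w -> Im z = Im w -> z = w.
Proof. by case: z; case: w => a b c d /= -> ->. Qed.

Lemma cmod_ge0 (z : R[i]) : 0 <= cmod z.
Proof. by rewrite /cmod normc_def/= sqrtr_ge0. Qed.

Lemma cmod2 (z : R[i]) : cmod z ^+ 2 = Re z ^+ 2 + Im z ^+ 2.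
Proof. by rewrite /cmod normc_def/= sqr_sqrtr// addr_ge0 ?sqr_ge0. Qed.

Lemma cmodB2_le (z w : R[i]) : cmod (z - w) ^+ 2 <= 2 * cmod z ^+ 2 + 2 * cmod w ^+ 2.
Proof.
have := sqr_ge0 (Re z + Re w); have := sqr_ge0 (Im z + Im w).
by rewrite !cmod2; case: z; case: w => a b c d /=; nra.
Qed.

(** Complex-valued square integrable functions, and the square of their norm. *)
Definition cL2 f := L2 (Re \o f) /\ L2 (Im \o f).
Definition sqnorm f : R := \int[mu]_(x in T01) cmod (f x) ^+ 2.

Lemma cL2D f g : cL2 f -> cL2 g -> cL2 (fun x => f x + g x).
Proof.
move=> [f1 f2] [g1 g2]; split.
  by under [X in L2 X]eq_fun do rewrite /= ReD; exact: L2D.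
by under [X in L2 X]eq_fun do rewrite /= ImD; exact: L2D.
Qed.

Lemma cL2Z (c : R[i]) f : cL2 f -> cL2 (fun x => c * f x).
Proof.
move=> [f1 f2]; split.
  under [X in L2 X]eq_fun do rewrite /= ReM -mulNr.
  by apply: L2D; apply: L2Z.
under [X in L2 X]eq_fun do rewrite /= ImM.
by apply: L2D; apply: L2Z.
Qed.

Lemma cL2B f g : cL2 f -> cL2 g -> cL2 (fun x => f x - g x).
Proof.
move=> hf hg; have := cL2D hf (cL2Z (-1) hg).
by under [X in cL2 X]eq_fun do rewrite mulN1r.
Qed.

Lemma cL2_sum n (c : nat -> R[i]) (phi : nat -> R -> R[i]) :
  (forall k, cL2 (phi k)) -> cL2 (fun x => \sum_(k < n) c k * phi k x).
Proof.
move=> hphi; elim: n => [|n IH].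
  under [X in cL2 X]eq_fun do rewrite big_ord0.
  by split; exact: L2_cst.
under [X in cL2 X]eq_fun do rewrite big_ord_recr/=.
by apply: cL2D => //; exact: cL2Z.
Qed.

Lemma innerE f g : cL2 f -> cL2 g -> inner f g =
  ((ip (Re \o f) (Re \o g) + ip (Im \o f) (Im \o g))
   +i* (ip (Im \o f) (Re \o g) - ip (Re \o f) (Im \o g)))%C.
Proof.
move=> [f1 f2] [g1 g2]; rewrite /inner /cintegral /ip; congr Complex.
  rewrite -(RintegralD _ (L2_integM f1 g1) (L2_integM f2 g2))//.
  by apply: eq_Rintegral => x _; rewrite ReM Re_conj Im_conj mulrN opprK.
rewrite -(RintegralB _ (L2_integM f2 g1) (L2_integM f1 g2))//.
by apply: eq_Rintegral => x _; rewrite ImM Re_conj Im_conj mulrN addrC.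
Qed.

Lemma innerDl f g h : cL2 f -> cL2 g -> cL2 h ->
  inner (fun x => f x + g x) h = inner f h + inner g h.
Proof.
move=> hf hg hh; rewrite !innerE//; last exact: cL2D.
move: hf hg hh => [f1 f2] [g1 g2] [h1 h2].
have eR : Re \o (fun x => f x + g x) = (fun x => (Re \o f) x + (Re \o g) x).
  by apply/funext => x /=; rewrite ReD.
have eI : Im \o (fun x => f x + g x) = (fun x => (Im \o f) x + (Im \o g) x).
  by apply/funext => x /=; rewrite ImD.
by rewrite eR eI !ipDl//; apply: complex_eq; rewrite ?ReD ?ImD/=; ring.
Qed.

Lemma innerZl (c : R[i]) f h : cL2 f -> cL2 h ->
  inner (fun x => c * f x) h = c * inner f h.
Proof.
move=> hf hh; rewrite !innerE//; last exact: cL2Z.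
move: hf hh => [f1 f2] [h1 h2].
have eR : Re \o (fun x => c * f x) =
    (fun x => Re c * (Re \o f) x + (- Im c) * (Im \o f) x).
  by apply/funext => x /=; rewrite ReM mulNr.
have eI : Im \o (fun x => c * f x) =
    (fun x => Re c * (Im \o f) x + Im c * (Re \o f) x).
  by apply/funext => x /=; rewrite ImM.
have z k (v : R -> R) : L2 v -> L2 (fun x => k * v x) by move=> ?; apply: L2Z.
rewrite eR eI !(ipDl, ipZl)//; try by apply: z.
by apply: complex_eq; rewrite ?ReM ?ImM/=; ring.
Qed.

Lemma innerC f g : cL2 f -> cL2 g -> inner g f = (inner f g)^*.
Proof.
move=> hf hg; rewrite !innerE//; apply: complex_eq; rewrite ?Re_conj ?Im_conj/=.
  by rewrite ipC [X in _ + X]ipC.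
by rewrite opprB ipC [X in _ - X]ipC.
Qed.

Lemma inner_suml n (c : nat -> R[i]) (phi : nat -> R -> R[i]) h :
  (forall k, cL2 (phi k)) -> cL2 h ->
  inner (fun x => \sum_(k < n) c k * phi k x) h = \sum_(k < n) c k * inner (phi k) h.
Proof.
move=> hphi hh; elim: n => [|n IH].
  rewrite big_ord0; have -> : (fun x => \sum_(k < 0) c k * phi k x) =
      (fun x => 0 * phi 0%N x) by apply/funext => x; rewrite big_ord0 mul0r.
  by rewrite innerZl// mul0r.
have -> : (fun x => \sum_(k < n.+1) c k * phi k x) =
    (fun x => \sum_(k < n) c k * phi k x + c n * phi n x).
  by apply/funext => x; rewrite big_ord_recr.
rewrite innerDl//; [|exact: cL2_sum|exact: cL2Z].
by rewrite IH innerZl// big_ord_recr.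
Qed.

Lemma integ_cmod2 f : cL2 f -> integ (fun x => cmod (f x) ^+ 2).
Proof.
by move=> [[_ f1] [_ f2]]; under [X in integ X]eq_fun do rewrite cmod2; exact: integD.
Qed.

Lemma sqnormE f : cL2 f -> sqnorm f = Re (inner f f).
Proof.
move=> hf; rewrite innerE//= /sqnorm.
have [f1 f2] := hf.
rewrite /ip -(RintegralD _ (L2_integM f1 f1) (L2_integM f2 f2))//.
by apply: eq_Rintegral => x _; rewrite cmod2 /= !expr2.
Qed.

Lemma sqnorm_ge0 f : 0 <= sqnorm f.
Proof. by apply: Rintegral_ge0 => x _; rewrite sqr_ge0. Qed.

Lemma pythagoras f g : cL2 f -> cL2 g -> inner f g = 0 ->
  sqnorm (fun x => f x + g x) = sqnorm f + sqnorm g.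
Proof.
move=> hf hg fg; have hfg := cL2D hf hg.
rewrite !sqnormE// innerDl//.
rewrite [inner f (fun x => _)]innerC// [inner g (fun x => _)]innerC//.
rewrite !innerDl// [inner g f]innerC// fg.
by rewrite ReD !Re_conj !ReD Re_conj/=; ring.
Qed.

(** Among the linear combinations of the first [n] functions of an orthonormal
   system, the partial sum of the expansion of [f] is closest to [f]. *)
Lemma best_approx (phi : nat -> R -> R[i]) f (c : nat -> R[i]) n :
  (forall k, cL2 (phi k)) -> cL2 f ->
  (forall i j, inner (phi i) (phi j) = (i == j)%:R) ->
  sqnorm (fun x => f x - \sum_(k < n) inner f (phi k) * phi k x) <=
  sqnorm (fun x => f x - \sum_(k < n) c k * phi k x).
Proof.
move=> hphi hf on.
pose a k := inner f (phi k).
pose d x := f x + -1 * \sum_(k < n) a k * phi k x.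
pose e x := \sum_(k < n) (a k - c k) * phi k x.
have hs (b : nat -> R[i]) : cL2 (fun x => \sum_(k < n) b k * phi k x) by exact: cL2_sum.
have hd : cL2 d by apply: cL2D => //; exact: cL2Z.
have dphi j : (j < n)%N -> inner d (phi j) = 0.
  move=> jn; rewrite /d innerDl//; last exact: cL2Z.
  rewrite innerZl// inner_suml// (bigD1 (Ordinal jn))//= on eqxx mulr1.
  rewrite big1 ?addr0 ?mulN1r ?subrr// => i.
  by rewrite -val_eqE/= on => /negbTE ->; rewrite mulr0.
have ed : inner e d = 0.
  rewrite (@inner_suml n (fun k => a k - c k) phi d hphi hd); apply: big1 => j _.
  by rewrite innerC// dphi ?ltn_ord// conjC0 mulr0.
have he : cL2 e by exact: (hs (fun k => a k - c k)).
have de : inner d e = 0 by rewrite (innerC he hd) ed conjC0.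
have -> : (fun x => f x - \sum_(k < n) c k * phi k x) = (fun x => d x + e x).
  apply/funext => x; rewrite /d /e mulN1r -addrA; congr (_ + _).
  by rewrite -sumrN -sumrN -big_split; apply: eq_bigr => k _ /=; ring.
rewrite (pythagoras hd he de).
have -> : (fun x => f x - \sum_(k < n) inner f (phi k) * phi k x) = d.
  by apply/funext => x; rewrite /d mulN1r.
by rewrite lerDl sqnorm_ge0.
Qed.

Lemma cLnorm2E f : (cLnorm 2%:E f `^ 2 = \int[mu]_(x in T01) (cmod (f x) ^+ 2)%:E)%E.
Proof.
rewrite /cLnorm poweR_Lnorm// [RHS]integral_mkcond; apply: eq_integral => x _.
rewrite !patchE; case: ifP => _; last by rewrite abse0 poweR0r.
by rewrite /= (ger0_norm (cmod_ge0 _)) powR_mulrn ?cmod_ge0.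
Qed.
End ComplexL2.

(** * Convergence of the partial sums in the mean *)

Section Lp.
Context {R : realType}.
Notation mu := (@lebesgue_measure R).
Notation Re := (@complex.Re R).
Notation Im := (@complex.Im R).
Implicit Types (f g : R -> R[i]) (K : scalars).

Lemma sqnorm_cLnorm f : cL2 f -> (cLnorm 2%:E f `^ 2 = (sqnorm f)%:E)%E.
Proof.
move=> hf; rewrite cLnorm2E /sqnorm fineK//.
by apply: integrable_fin_num => //; exact: integ_cmod2.
Qed.

Lemma inLp_cL2 K f : inLp K 2%:E f -> cL2 f.
Proof.
move=> [_ mR mI /(fun h => poweR_lty 2 h)]; rewrite cLnorm2E => fin.
have i2 : integ (fun x => cmod (f x) ^+ 2).
  apply/integrableP; split.
    apply/measurable_EFinP.
    have -> : (fun x => cmod (f x) ^+ 2) = (fun x => (Re \o f) x ^+ 2 + (Im \o f) x ^+ 2).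
      by apply/funext => x; rewrite cmod2.
    by apply: measurable_funD; apply: measurable_funX.
  under eq_integral do rewrite /= ger0_norm ?sqr_ge0//.
  exact: fin.
split; split=> //.
  apply: integ_le i2 _; first exact: measurable_funX.
  by move=> x _; rewrite cmod2 ger0_norm ?sqr_ge0// lerDl sqr_ge0.
apply: integ_le i2 _; first exact: measurable_funX.
by move=> x _; rewrite cmod2 ger0_norm ?sqr_ge0// lerDr sqr_ge0.
Qed.

Lemma sqnorm_lt f (e : R) : cL2 f -> (cLnorm 2%:E f < e%:E)%E -> sqnorm f < e ^+ 2.
Proof.
move=> /sqnorm_cLnorm; have : (0 <= cLnorm 2%:E f)%E by exact: Lnorm_ge0.
case: (cLnorm _ f) => [r| |]//=.
rewrite lee_fin lte_fin => r0 + re; rewrite powR_mulrn// => -[<-].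
by rewrite ltr_pXn2r// ?nnegrE// (le_trans r0)// ltW.
Qed.

(** A real function, regarded as complex-valued. *)
Definition real_fun (u : R -> R) : R -> R[i] := fun x => (u x)%:C%C.

Lemma in_scalars_real K (r : R) : in_scalars K r%:C%C.
Proof. by case: K => //=; rewrite complex_real. Qed.

Lemma cmod_real (r : R) : cmod r%:C%C = `|r|.
Proof. by rewrite /cmod normc_def/= expr0n/= addr0 sqrtr_sqr. Qed.

Lemma cL2_real u : L2 u -> cL2 (real_fun u).
Proof. by move=> hu; split => //=; exact: L2_cst. Qed.

Lemma inL2_real K u : L2 u -> inLp K 2%:E (real_fun u).
Proof.
move=> hu; split.
- by move=> x _; exact: in_scalars_real.
- by case: hu.
- exact: measurable_cst.
- apply: (@lty_poweRy _ _ 2) => //; rewrite sqnorm_cLnorm ?ltry//.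
  exact: cL2_real.
Qed.

Lemma inLoo_real K (u : R -> R) (C : R) : measurable_fun T01 u ->
  (forall x, T01 x -> `|u x| <= C) -> inLp K +oo%E (real_fun u).
Proof.
move=> mu_ uC; split => //.
- by move=> x _; exact: in_scalars_real.
- exact: measurable_cst.
- rewrite /cLnorm Lnorm.unlock; case: ifP => // _.
  apply: (@le_lt_trans _ _ `|C|%:E); last exact: ltry.
  apply/ess_supP; apply: nearW => x /=.
  rewrite patchE; case: ifP => [/set_mem xT|_]; last by rewrite abse0 lee_fin.
  by rewrite /= lee_fin cmod_real normr_id (le_trans (uC _ xT))// ler_norm.
Qed.

Lemma cL2_partial_sum (phi : nat -> R -> R[i]) f m :
  (forall k, cL2 (phi k)) -> cL2 (partial_sum phi f m).
Proof. by move=> hphi; exact: (cL2_sum m.+1 (fun k => inner f (phi k)) hphi). Qed.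

(** The strict lower bound [m] lets the order of the partial sum be chosen as large
   as desired. *)
Lemma partial_sum_cvg K (phi : nat -> R -> R[i]) g (e : R) m :
  orthonormal_system K phi -> complete_system K phi -> inLp K 2%:E g -> 0 < e ->
  exists2 M, (m < M)%N & sqnorm (fun x => g x - partial_sum phi g M x) <= e.
Proof.
move=> [hphi on] comp hg e0.
have cphi k : cL2 (phi k) by exact: inLp_cL2 (hphi k).
have cg : cL2 g by exact: inLp_cL2 hg.
have se0 : 0 < Num.sqrt e by rewrite sqrtr_gt0.
have [N [c [_ hc]]] := comp g hg _ se0.
pose M := (maxn m N).+1; exists M; first by rewrite ltnS leq_maxl.
pose c' k := if (k < N)%N then c k else 0.
apply: le_trans (@best_approx _ phi g c' M.+1 cphi cg on) _.
have -> : (fun x => g x - \sum_(k < M.+1) c' k * phi k x) =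
    (fun x => g x + -1 * \sum_(k < N) c k * phi k x).
  apply/funext => x; rewrite mulN1r; congr (_ - _).
  have NM : (N <= M.+1)%N by rewrite !leqW// leq_maxr.
  rewrite (big_ord_widen _ (fun k => c k * phi k x) NM) [RHS]big_mkcond/=.
  by apply: eq_bigr => k _; rewrite /c'; case: ifP => //; rewrite mul0r.
rewrite -[e]sqr_sqrtr ?(ltW e0)//; apply/ltW/sqnorm_lt.
  by apply: cL2D => //; apply: cL2Z; exact: cL2_sum.
by under [X in cLnorm _ X]eq_fun do rewrite mulN1r.
Qed.

Lemma sqnorm_sum (phi : nat -> R -> R[i]) (c : nat -> R[i]) n :
  (forall k, cL2 (phi k)) ->
  (forall i j, inner (phi i) (phi j) = (i == j)%:R) ->
  sqnorm (fun x => \sum_(k < n) c k * phi k x) = \sum_(k < n) cmod (c k) ^+ 2.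
Proof.
move=> hphi on; have hs := cL2_sum n c hphi.
rewrite sqnormE// (inner_suml n c hphi hs).
have e j : (j < n)%N -> inner (fun x => \sum_(k < n) c k * phi k x) (phi j) = c j.
  move=> jn; rewrite inner_suml// (bigD1 (Ordinal jn))//= on eqxx mulr1.
  by rewrite big1 ?addr0// => i; rewrite -val_eqE/= on => /negbTE ->; rewrite mulr0.
have -> : \sum_(k < n) c k * inner (phi k) (fun x => \sum_(k < n) c k * phi k x) =
   \sum_(k < n) ((cmod (c k) ^+ 2)%:C)%C.
  apply: eq_bigr => k _; rewrite (innerC hs (hphi k)) e//.
  by apply: complex_eq; rewrite ?ReM ?ImM Re_conj Im_conj cmod2/=; ring.
by elim/big_ind2 : _ => // z a w b; rewrite ReD => -> ->.
Qed.

Lemma sqnormB_le f g : cL2 f -> cL2 g ->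
  sqnorm (fun x => f x - g x) <= 2 * sqnorm f + 2 * sqnorm g.
Proof.
move=> hf hg.
have i1 := integ_cmod2 hf; have i2 := integ_cmod2 hg.
have i3 : integ (fun x => cmod (f x - g x) ^+ 2).
  have := integ_cmod2 (cL2D hf (cL2Z (-1) hg)).
  by under [X in integ X]eq_fun do rewrite mulN1r.
have i1' := integZ 2 i1; have i2' := integZ 2 i2.
rewrite /sqnorm -(RintegralZl _ _ i1)// -(RintegralZl _ _ i2)//.
rewrite -(RintegralD _ i1' i2')//; apply: le_Rintegral => //; first exact: integD.
by move=> x _; exact: cmodB2_le.
Qed.

End Lp.

(** * Stability of an infinite quadratic variation *)

Section DeterministicV2.
Context {R : realType}.
Implicit Types (u : nat -> R) (M : nat -> nat).

Lemma var_gap u a b : (a <= b)%N -> exists2 v, 0 <= v & var_path u a b v.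
Proof.
rewrite leq_eqVlt => /predU1P[->|ab]; first by exists 0 => //; exact: var_nil.
by exists ((u b - u a) ^+ 2); [exact: sqr_ge0|exact: var_one].
Qed.

(** Infinitely many blocks of variation at least 1 add up; the gaps between them
   contribute nonnegatively. *)
Lemma var_unbounded u (K : nat -> nat) :
  (forall i, K i < K i.+1)%N ->
  (forall m, exists2 i, (m <= i)%N & var_ge1 u (K i) (K i.+1)) ->
  forall m n, exists b, exists2 v, n%:R <= v & var_path u (K m) b v.
Proof.
move=> Klt inf m n.
have Kmono : {homo K : i j / (i <= j)%N}.
  by apply: homo_leq leq_trans _ => // i; exact: ltnW.
suff [i [v nv p]] : exists i, exists2 v, n%:R <= v & var_path u (K m) (K i) v.
  by exists (K i), v.
elim: n => [|n [i [v nv p]]]; first by exists m, 0 => //; exact: var_nil.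
have [j ij [w w1 q]] := inf i.
have [z z0 r] := var_gap u (Kmono _ _ ij).
exists j.+1, (v + z + w); last by apply: var_cat q; exact: var_cat r.
by rewrite -natr1; lra.
Qed.

(** A perturbation of a real sequence by an error costs at most half of its
   quadratic variation, up to a multiple of the sum of the squared errors. *)
Lemma var_perturb u (e : nat -> R[i]) (T : nat -> R[i]) a b v :
  (0 < a)%N ->
  (forall k, (0 < k)%N -> T k = (u k)%:C%C + e k) ->
  var_path u a b v ->
  exists L (n : nat -> nat), [/\ n 0%N = a, n L = b,
    forall l, (l < L)%N -> (n l < n l.+1)%N &
    v <= 2 * \sum_(l < L) cmod (T (n l.+1) - T (n l)) ^+ 2 +
         8 * \sum_(k < b.+1) cmod (e k) ^+ 2].
Proof.
move=> a0 Te p.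
pose A n := \sum_(k < n) cmod (e k) ^+ 2.
have Amono : {homo A : i j / (i <= j)%N >-> i <= j}.
  apply: homo_leq => // [i j k|i]; first exact: le_trans.
  by rewrite /A big_ord_recr/= lerDl sqr_ge0.
have A0 n : 0 <= A n by apply: sumr_ge0 => i _; exact: sqr_ge0.
have AS n : A n.+1 = A n + cmod (e n) ^+ 2 by rewrite /A big_ord_recr.
suff [L [n [n0 nL nlt h]]] : exists L (n : nat -> nat), [/\ n 0%N = a, n L = b,
    forall l, (l < L)%N -> (n l < n l.+1)%N &
    v <= 2 * \sum_(l < L) cmod (T (n l.+1) - T (n l)) ^+ 2 + 4 * A b + 4 * A b.+1].
  exists L, n; split => //; apply: le_trans h _.
  by rewrite -addrA lerD2l -/(A b.+1); have := Amono _ _ (leqnSn b); lra.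
elim: p => [|c d w pc [L [n [n0 nL nlt h]]] cd].
  exists 0%N, (fun=> a); split => //.
  by rewrite big_ord0 mulr0 add0r addr_ge0// mulr_ge0.
have c0 : (0 < c)%N by rewrite (leq_trans a0)// (var_path_le pc).
exists L.+1, (fun l => if (l <= L)%N then n l else d); split.
- by rewrite leq0n.
- by rewrite ltnn.
- move=> l; rewrite ltnS => lL; rewrite lL; case: (ltnP l L) => h'; first exact: nlt.
  have -> : l = L by apply/eqP; rewrite eqn_leq lL h'.
  by rewrite nL.
rewrite big_ord_recr/= leqnn ltnn nL.
have -> : \sum_(i < L) cmod (T (if (i < L)%N then n i.+1 else d) -
     T (if (i <= L)%N then n i else d)) ^+ 2 = \sum_(l < L) cmod (T (n l.+1) - T (n l)) ^+ 2.
  by apply: eq_bigr => i _; rewrite ltn_ord ltnW.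
set W := \sum_(l < L) _ in h *.
have h1 := Amono _ _ cd; have ASc := AS c; have ASd := AS d.
(* u d - u c = (T d - T c) - (e d - e c). *)
have key : (u d - u c) ^+ 2 <= 2 * cmod (T d - T c) ^+ 2 +
    4 * cmod (e d) ^+ 2 + 4 * cmod (e c) ^+ 2.
  have := cmodB2_le (T d - T c) (e d - e c).
  have -> : T d - T c - (e d - e c) = (u d - u c)%:C%C.
    by rewrite !Te ?(ltn_trans c0 cd)//; rewrite rmorphB/=; ring.
  rewrite cmod_real real_normK ?num_real//.
  by have := cmodB2_le (e d) (e c); lra.
by lra.
Qed.
End DeterministicV2.

(** * Almost everywhere statements *)

Section AlmostEverywhere.
Context {R : realType}.
Notation mu := (@lebesgue_measure R).

(** If [S (M k)] follows, up to a square summable error, a real sequence with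
   infinitely many blocks of variation at least 1, then [S] has infinite
   2-variation. *)
Lemma V2_infinite (S : nat -> R -> R[i]) x (u : nat -> R) (e : nat -> R[i])
    (K M : nat -> nat) (C : R) :
  (forall i, K i < K i.+1)%N -> (forall k, M k < M k.+1)%N ->
  (forall m, exists2 i, (m <= i)%N & var_ge1 u (K i) (K i.+1)) ->
  (forall k, (0 < k)%N -> S (M k) x = (u k)%:C%C + e k) ->
  (forall n, \sum_(k < n) cmod (e k) ^+ 2 <= C) ->
  V2 S x = +oo%E.
Proof.
move=> Klt Mlt inf Se eC.
have Mmono : {homo M : i j / (i < j)%N} by exact: (homo_ltn ltn_trans Mlt).
apply/eqyP => A A0.
have [b [v nv p]] := var_unbounded Klt inf 1 (Num.bound (2 * A ^+ 2 + 8 * C)).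
have C0 : 0 <= C by have := eC 0%N; rewrite big_ord0.
have hv : 2 * A ^+ 2 + 8 * C <= v.
  apply: le_trans nv; apply/ltW/archi_boundP.
  by rewrite addr_ge0// mulr_ge0// sqr_ge0.
have K1 : (0 < K 1)%N by exact: leq_ltn_trans (Klt 0%N).
have [L [n [_ _ nlt h]]] := var_perturb (T := fun k => S (M k) x) K1 Se p.
have hW := eC b.+1.
set W := \sum_(l < L) _ in h.
have AW : A ^+ 2 <= W by lra.
apply: (@le_trans _ _ (Num.sqrt W)%:E).
  by rewrite lee_fin -[A]ger0_norm ?(ltW A0)// -sqrtr_sqr ler_wsqrtr.
apply: ereal_sup_ubound; exists L, (M \o n); split => //.
by move=> l /nlt; exact: Mmono.
Qed.

(** The sum of the squared moduli of the [e k] has a finite integral. *)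
Lemma ae_square_summable (e : nat -> R -> R[i]) (c : R) :
  (forall k, cL2 (e k)) -> (forall k, sqnorm (e k) <= c * 2^-1 ^+ k) ->
  {ae mu, forall x, T01 x ->
     exists C, forall n, \sum_(k < n) cmod (e k x) ^+ 2 <= C}.
Proof.
move=> he hc.
pose f k x : \bar R := (cmod (e k x) ^+ 2)%:E.
have f0 k x : (0 <= f k x)%E by rewrite lee_fin sqr_ge0.
have mf k : measurable_fun T01 (f k).
  exact: measurable_int (integ_cmod2 (he k)).
have c0 : 0 <= c by have := le_trans (sqnorm_ge0 _) (hc 0%N); rewrite expr0 mulr1.
have intf : mu.-integrable T01 (fun x => \sum_(0 <= k <oo) f k x)%E.
  apply/integrableP; split.
    by apply: ge0_emeasurable_sum => [k x _ _|k _]; [exact: f0|exact: mf].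
  under eq_integral do rewrite gee0_abs ?nneseries_ge0//.
  rewrite integral_nneseries//.
  apply: (@le_lt_trans _ _ (2 * c)%:E); last exact: ltry.
  apply: lime_le; first by apply: is_cvg_nneseries => k _ _; exact: integral_ge0.
  apply: nearW => n; rewrite (eq_bigr (fun k => (sqnorm (e k))%:E)); last first.
    move=> k _; rewrite /sqnorm fineK//.
    by apply: integrable_fin_num => //; exact: integ_cmod2.
  rewrite sumEFin lee_fin.
  apply: (@le_trans _ _ (\sum_(0 <= k < n) c * 2^-1 ^+ k)).
    by apply: ler_sum => k _; exact: hc.
  rewrite -mulr_sumr mulrC ler_wpM2r// big_mkord.
  suff -> : \sum_(k < n) 2^-1 ^+ k = 2 - 2 * 2^-1 ^+ n :> R.
    by rewrite lerBlDr lerDl mulr_ge0// exprn_ge0// invr_ge0.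
  elim: n => [|n IH]; first by rewrite big_ord0 expr0 mulr1 subrr.
  by rewrite big_ord_recr/= IH exprS; field.
have := integrable_ae _ intf; move=> /(_ measurable_T01); apply: filterS => x + xT => /(_ xT) fin.
exists (fine (\sum_(0 <= k <oo) f k x)%E) => n.
rewrite -lee_fin fineK// -sumEFin -(big_mkord xpredT (fun k => f k x)).
exact: nneseries_lim_ge.
Qed.

(** Events of probability at most 2^-i, each depending on finitely many digits,
   almost surely fail for arbitrarily large [i]. *)
Lemma ae_bits (H : nat -> seq bool -> bool) (ns : nat -> seq nat) :
  (forall i, sorted ltn (0%N :: ns i)) ->
  (forall i, avg (size (ns i)) (fun s => ind (H i s)) <= 2^-1 ^+ i :> R) ->
  {ae mu, forall x, T01 x -> forall m, exists2 i, (m <= i)%N & ~~ H i (bits (ns i) x)}.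
Proof.
move=> hs hH.
pose B i : set R := T01 `&` [set x | H i (bits (ns i) x)].
have mB i : measurable (B i).
  pose h (x : R) : R := ind (H i (bits (ns i) x)).
  have mh : measurable_fun T01 h by exact: (measurable_bits (fun s => ind (H i s))).
  have := mh measurable_T01 [set 1] (measurable_set1 1).
  congr (measurable _); apply/seteqP; split=> x [xT]/=; rewrite /h /ind.
    by move=> h1; split => //=; move: h1; case: (H i _) => //= /eqP; rewrite eq_sym oner_eq0.
  by move=> ->.
have muB i : (mu (B i) <= (2^-1 ^+ i)%:E)%E.
  have BT : B i `<=` T01 by move=> x [].
  have le1 : (mu (B i) <= mu T01)%E.
    apply: le_measure; rewrite ?inE; [exact: mB|exact: measurable_T01|exact: BT].
  have fB : mu (B i) \is a fin_num.
    rewrite ge0_fin_numE//; apply: le_lt_trans le1 _.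
    by apply: (eq_ind_r (fun z => (z < +oo)%E) (ltry 1) mu_T01).
  rewrite -(fineK fB) lee_fin; apply: le_trans (hH i).
  rewrite -int_bits//.
  have <- : \int[mu]_(x in T01) \1_(B i) x = fine (mu (B i)).
    rewrite -{2}(setIidl BT); congr fine.
    exact: (integral_indic mu measurable_T01 (mB i)).
  rewrite le_eqVlt; apply/orP; left; apply/eqP.
  apply: eq_Rintegral => x /set_mem xT; rewrite indicE /ind; congr ((nat_of_bool _)%:R).
  apply/idP/idP; first by move=> /set_mem[].
  by move=> h; apply/mem_set.
have neg m : {ae mu, forall x, T01 x -> exists2 i, (m <= i)%N & ~~ H i (bits (ns i) x)}.
  exists (\bigcap_(i in [set i | (m <= i)%N]) B i); split.
  - by apply: bigcap_measurable => [|k _]; [exists m => /=|exact: mB].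
  - apply/eqP; rewrite eq_le measure_ge0 andbT.
    apply/lee_addgt0Pr => e e0; rewrite add0e.
    pose i := maxn m (Num.bound e^-1).
    have mi : (m <= i)%N by exact: leq_maxl.
    apply: (@le_trans _ _ (mu (B i))).
      apply: le_measure; rewrite ?inE; [|exact: mB|by move=> x h; exact: (h i mi)].
      by apply: bigcap_measurable => [|k _]; [exists m => /=|exact: mB].
    apply: le_trans (muB i) _; rewrite lee_fin exprVn invf_ple ?posrE ?exprn_gt0//.
    apply: (@le_trans _ _ i%:R).
      apply: (@le_trans _ _ (Num.bound e^-1)%:R); last by rewrite ler_nat leq_maxr.
      by apply/ltW/archi_boundP; rewrite invr_ge0 ltW.
    by rewrite -natrX ler_nat ltnW// ltn_expl.
  - move=> x /= /not_implyP[xT nx] i mi; split => //=.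
    by apply: contrapT => /negP h; apply: nx; exists i.
have : {ae mu, forall x m, T01 x -> exists2 i, (m <= i)%N & ~~ H i (bits (ns i) x)}.
  exact/ae_foralln.
move=> h0; apply: (@filterS _ _ (ae_filter_ringOfSetsType mu)) h0 => x h xT m.
exact: h.
Qed.

End AlmostEverywhere.

(** * Choice of digits and frequencies *)

Section Construction.
Context {R : realType}.
Notation mu := (@lebesgue_measure R).
Notation Re := (@complex.Re R).
Notation Im := (@complex.Im R).

(** Summing the oscillations 2^-j over the blocks j >= i. *)
Lemma block_bound (F : seq bool -> R) (K : nat -> nat) :
  (forall i, K i < K i.+1)%N ->
  (forall i s, (K i <= size s <= K i.+1)%N ->
     `|F s - F (take (K i) s)| <= 2^-1 ^+ i) ->
  forall i s, (K i <= size s)%N -> `|F s - F (take (K i) s)| <= 2 * 2^-1 ^+ i.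
Proof.
move=> Klt FK i s Ks.
have p0 d : 0 <= 2^-1 ^+ d :> R by rewrite exprn_ge0// invr_ge0.
suff H d t : (K i <= size t <= K (i + d))%N ->
    `|F t - F (take (K i) t)| <= 2 * 2^-1 ^+ i - 2 * 2^-1 ^+ (i + d).
  have Kge j : (j <= K j)%N by elim: j => // j IH; exact: leq_ltn_trans IH (Klt j).
  apply: le_trans (H (size s) s _) _; last by have := p0 (i + size s)%N; lra.
  by rewrite Ks (leq_trans _ (Kge _))// leq_addl.
elim: d t => [|d IH] t /andP[t1 t2].
  by rewrite addn0 in t2 *; rewrite take_oversize// !subrr normr0.
have e : 2^-1 ^+ (i + d.+1) = 2^-1 * 2^-1 ^+ (i + d) :> R by rewrite addnS exprS.
case: (leqP (size t) (K (i + d))) => t3.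
  apply: le_trans (IH t _) _; first by rewrite t1.
  by have := p0 (i + d)%N; rewrite e; lra.
have Kid : (K i <= K (i + d))%N.
  by apply: (homo_leq (fun=> leqnn _) leq_trans); [move=> j; exact: ltnW|exact: leq_addr].
have := FK (i + d)%N t; rewrite (ltnW t3) -addnS t2 => /(_ isT) h1.
have := IH (take (K (i + d)) t); rewrite size_takel ?(ltnW t3)// Kid leqnn => /(_ isT).
rewrite take_takel// => h2.
rewrite -(subrKA (F (take (K (i + d)) t))); apply: le_trans (ler_normD _ _) _.
by rewrite e; lra.
Qed.

(** The value of [F] on the digits of [x] in the positions [ns]. *)
Definition digit_fun (F : seq bool -> R) (ns : seq nat) (x : R) : R := F (bits ns x).

(** One step of the construction, from positions and order [p] to [q]: a new digit,
   whose contribution is almost orthogonal to the functions of index at most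
   [p.2], and a new order [q.2], for which the partial sum of the enlarged
   function is close to it in the mean. *)
Definition step (phi : nat -> R -> R[i]) (F : seq bool -> R) k (p q : seq nat * nat) :=
  exists n, [/\ q.1 = rcons p.1 n.+1, all (fun m => m <= n)%N p.1, (p.2 < q.2)%N,
    forall l, (l <= p.2)%N ->
      `|ip (fun x => digit_fun F q.1 x - digit_fun F p.1 x) (Re \o phi l)|
          <= 2^-1 ^+ k / p.2.+1%:R /\
      `|ip (fun x => digit_fun F q.1 x - digit_fun F p.1 x) (Im \o phi l)|
          <= 2^-1 ^+ k / p.2.+1%:R &
    sqnorm (fun x => real_fun (digit_fun F q.1) x -
       partial_sum phi (real_fun (digit_fun F q.1)) q.2 x) <= 2^-1 ^+ k].

Lemma step_exists K (phi : nat -> R -> R[i]) (F : seq bool -> R) (C : R) :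
  orthonormal_system K phi -> complete_system K phi ->
  (forall s, F (rcons s true) + F (rcons s false) = 2 * F s) ->
  (forall s, `|F s| <= C) ->
  forall k p, exists q, step phi F k p q.
Proof.
move=> ons comp mart FC k [ns M]; have [hphi _] := ons.
have cphi l : cL2 (phi l) by exact: inLp_cL2 (hphi l).
have hF t : L2 (digit_fun F t).
  by apply: (@L2_bounded _ _ C) => [|x _]; [exact: measurable_bits|exact: FC].
pose h s := F (rcons s true) - F s.
have hC s : `|h s| <= C + C by apply: le_trans (ler_normB _ _) _; exact: lerD.
(* The real and imaginary parts of phi 0, ..., phi M, listed alternately. *)
pose psi j x := (if odd j then Im (phi j./2 x) else Re (phi j./2 x)).
have hpsi j : L2 (psi j).
  rewrite /psi; case: (odd j); first by have [_] := cphi j./2.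
  by have [] := cphi j./2.
have hpsi' j : L2 (fun x => h (bits ns x) * psi j x).
  apply: (L2_mulb (C := C + C) (hpsi j)) => [|x _]; last exact: hC.
  exact: (measurable_bits h).
pose dlt : R := 2^-1 ^+ k / M.+1%:R.
have dlt0 : 0 < dlt by rewrite divr_gt0// exprn_gt0// invr_gt0.
have [n nn hn] := small_coefs (M.+1).*2 (\max_(m <- ns) m) hpsi' dlt0.
have small j : (j < (M.+1).*2)%N ->
   `|ip (fun x => digit_fun F (rcons ns n.+1) x - digit_fun F ns x) (psi j)| <= dlt.
  move=> /hn; congr (`|_| <= _); apply: eq_Rintegral => x _.
  rewrite /digit_fun /bits map_rcons -/(bits ns x) /rademacher /h /sgb.
  have := mart (bits ns x); case: (bit _ x) => [_|e]; first by ring.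
  have -> : F (rcons (bits ns x) false) = 2 * F (bits ns x) - F (rcons (bits ns x) true).
    by rewrite -e; ring.
  by ring.
have k0 : 0 < (2^-1 : R) ^+ k by rewrite exprn_gt0// invr_gt0.
have [M' MM' hM'] := @partial_sum_cvg R K phi (real_fun (digit_fun F (rcons ns n.+1)))
  (2^-1 ^+ k) M ons comp (inL2_real K (hF _)) k0.
exists (rcons ns n.+1, M'), n; split => //=.
  by apply/allP => m mns; rewrite (leq_trans _ nn)// leq_bigmax_seq.
move=> l lM; split.
  have := small l.*2; rewrite /psi odd_double doubleK; apply.
  by rewrite ltn_double ltnS.
have := small l.*2.+1; rewrite /psi /= odd_double/= uphalf_double; apply.
by rewrite doubleS !ltnS leq_double.
Qed.

Lemma steps_exist (phi : nat -> R -> R[i]) (F : seq bool -> R) :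
  (forall k p, exists q, step phi F k p q) ->
  exists (ns : nat -> seq nat) (M : nat -> nat),
    [/\ ns 0%N = [::],
        forall k, step phi F k (ns k, M k) (ns k.+1, M k.+1),
        forall k, (M k < M k.+1)%N,
        forall k, size (ns k) = k /\ sorted ltn (0%N :: ns k) &
        forall j k, (j <= k)%N -> take j (ns k) = ns j].
Proof.
move=> ex.
have [G HG] := choice (fun p : nat * (seq nat * nat) => ex p.1 p.2).
pose st := fix st k := if k is k'.+1 then G (k', st k') else ([::], 0%N).
have hst k : step phi F k (st k) (st k.+1) by exact: (HG (k, st k)).
pose ns k := (st k).1; pose M k := (st k).2.
have nsS k : exists2 n, ns k.+1 = rcons (ns k) n.+1 & all (fun m => m <= n)%N (ns k).
  by have [n []] := hst k; exists n.
have sns k : size (ns k) = k.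
  by elim: k => // k IH; have [n -> _] := nsS k; rewrite size_rcons IH.
exists ns, M; split => //.
- by move=> k; have [n []] := hst k.
- move=> k; split => //; elim: k => // k IH; have [n -> /allP an] := nsS k.
  rewrite /= rcons_path; apply/andP; split => //.
  by have := mem_last 0%N (ns k); rewrite inE => /predU1P[->|/an].
- move=> j k /subnKC <-; elim: (k - j)%N => [|d IH].
    by rewrite addn0 take_oversize// sns.
  have [n e _] := nsS (j + d)%N.
  by rewrite addnS e -cats1 takel_cat ?sns ?leq_addr.
Qed.

End Construction.

(** * The limit function and its partial sums *)

Section Limit.
Context {R : realType}.
Notation mu := (@lebesgue_measure R).
Notation Re := (@complex.Re R).
Notation Im := (@complex.Im R).

Lemma inner_real (w : R -> R) (g : R -> R[i]) : L2 w -> cL2 g ->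
  inner (real_fun w) g = ((ip w (Re \o g)) +i* (- ip w (Im \o g)))%C.
Proof.
move=> hw hg; rewrite innerE//; last exact: cL2_real.
have i0 h : ip (Im \o real_fun w) h = 0.
  rewrite /ip -[RHS](mul0r (fine (mu (@T01 R)))) -Rintegral_cst//.
  by apply: eq_Rintegral => x _; rewrite /= mul0r.
by rewrite !i0 addr0 sub0r.
Qed.

Lemma half_small (A e : R) : 0 <= A -> 0 < e -> exists i, A * 2^-1 ^+ i <= e.
Proof.
move=> A0 e0; exists (Num.bound (A / e)).
rewrite exprVn ler_pdivrMr ?exprn_gt0// mulrC -ler_pdivrMr//.
apply: (@le_trans _ _ (Num.bound (A / e))%:R).
  by apply/ltW/archi_boundP; rewrite divr_ge0// ltW.
by rewrite -natrX ler_nat ltnW// ltn_expl.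
Qed.

Lemma uniform_limit (v : nat -> R -> R) (N : nat -> nat) :
  (forall i j k x, (N i <= j)%N -> (N i <= k)%N ->
     `|v k x - v j x| <= 4 * 2^-1 ^+ i) ->
  exists u : R -> R, (forall x, v ^~ x @ \oo --> u x) /\
    forall i k x, (N i <= k)%N -> `|u x - v k x| <= 4 * 2^-1 ^+ i.
Proof.
move=> hv.
have cv x : cvg (v ^~ x @ \oo).
  apply: cauchy_cvg; apply: cauchy_exP => e e0.
  have [i hi] := @half_small 4 (e / 2) (ler0n _ _) (divr_gt0 e0 (ltr0n _ 2)).
  exists (v (N i) x), (N i) => //= k Nk; rewrite /ball/= distrC.
  apply: (@le_lt_trans _ _ (4 * 2^-1 ^+ i)); first exact: hv.
  by apply: (le_lt_trans hi); rewrite ltr_pdivrMr// ltr_pMr// ltr1n.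
exists (fun x => limn (v ^~ x)); split=> [x|i k x Nk]; first exact: cv.
apply/ler_addgt0Pr => e e0.
have /cvgrPdist_le /(_ _ e0) [n _ hn] := cv x.
pose j := maxn n (N i).
have h1 : `|limn (v ^~ x) - v j x| <= e by apply: hn; rewrite /= leq_maxl.
have h2 : `|v j x - v k x| <= 4 * 2^-1 ^+ i by apply: hv => //; exact: leq_maxr.
rewrite -(subrKA (v j x)); apply: le_trans (ler_normD _ _) _.
by rewrite addrC lerD.
Qed.

(** If the increments of order j contribute at most 2^-j / (M j + 1) to a
   coefficient for every j >= k, the remainder of order k of the limit
   contributes at most twice the bound for j = k. *)
Lemma tail_coef (v : nat -> R -> R) (u psi : R -> R) (N M : nat -> nat) (C D : R) k :
  {homo M : i j / (i <= j)%N} ->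
  (forall k, measurable_fun T01 (v k)) -> (forall k x, `|v k x| <= C) ->
  measurable_fun T01 u -> (forall x, `|u x| <= D) ->
  (forall i k x, (N i <= k)%N -> `|u x - v k x| <= 4 * 2^-1 ^+ i) ->
  L2 psi ->
  (forall j, (k <= j)%N ->
     `|ip (fun x => v j.+1 x - v j x) psi| <= 2^-1 ^+ j / (M j).+1%:R) ->
  `|ip (fun x => u x - v k x) psi| <= 2 * (2^-1 ^+ k / (M k).+1%:R).
Proof.
move=> Mmono mv vC mu_ uD uv hpsi hj.
have hu : L2 u by apply: (L2_bounded mu_ (C := D)).
have hv i : L2 (v i) by apply: (L2_bounded (mv i) (C := C)).
pose dlt k : R := 2^-1 ^+ k / (M k).+1%:R.
have p0 i : 0 < 2^-1 ^+ i :> R by rewrite exprn_gt0// invr_gt0.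
have dlt0 i : 0 < dlt i by rewrite divr_gt0.
rewrite -/(dlt k).
have fin d : `|ip (fun x => v (k + d)%N x - v k x) psi| <=
    2 * dlt k - 2 * dlt k * 2^-1 ^+ d.
  elim: d => [|d IH].
    rewrite expr0 mulr1 subrr addn0.
    under [X in ip X]eq_fun do rewrite subrr.
    by rewrite /ip; under eq_Rintegral do rewrite mul0r; rewrite Rintegral_cst// mul0r normr0.
  have -> : (fun x => v (k + d.+1)%N x - v k x) =
     (fun x => (v (k + d).+1 x - v (k + d)%N x) + (v (k + d)%N x - v k x)).
    by apply/funext => x; rewrite addnS; ring.
  rewrite ipDl//; [|exact: L2B|exact: L2B].
  apply: le_trans (ler_normD _ _) _.
  have h : dlt (k + d)%N <= dlt k * 2^-1 ^+ d.
    rewrite /dlt exprD mulrAC ler_wpM2r ?(ltW (p0 _))// ler_wpM2l ?(ltW (p0 _))//.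
    by rewrite lef_pV2 ?posrE// ler_nat ltnS Mmono// leq_addr.
  by have := hj (k + d)%N (leq_addr _ _); rewrite -/(dlt _) exprS; lra.
apply/ler_addgt0Pr => e e0.
pose A := \int[mu]_(x in T01) `|psi x|.
have A0 : 0 <= A by apply: Rintegral_ge0.
have [i hi] := @half_small (4 * A) e (mulr_ge0 (ler0n _ _) A0) e0.
have -> : (fun x => u x - v k x) =
    (fun x => (u x - v (k + N i)%N x) + (v (k + N i)%N x - v k x)).
  by apply/funext => x; ring.
rewrite ipDl//; [|exact: L2B|exact: L2B].
apply: le_trans (ler_normD _ _) _.
have h1 : `|ip (fun x => u x - v (k + N i)%N x) psi| <= 4 * 2^-1 ^+ i * A.
  apply: ip_bound => //; first exact: measurable_funB.
  by move=> x _; apply: uv; exact: leq_addl.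
have h2 := fin (N i).
have h3 : 0 <= 2 * dlt k * 2^-1 ^+ N i by rewrite !mulr_ge0// ltW.
by lra.
Qed.

End Limit.

Theorem theorem5 (R : realType) (K : scalars) (phi : nat -> R -> R[i]) :
  orthonormal_system K phi -> complete_system K phi ->
  exists f : R -> R[i],
    inLp K +oo%E f /\
    {ae lebesgue_measure, forall x, T01 x -> V2 (partial_sum phi f) x = +oo%E}.
Proof.
move=> ons comp; have [hphi on] := ons.
have cphi l : cL2 (phi l) by exact: inLp_cL2 (hphi l).
have [F [N [F0 mart [N0 Nlt] FN bad]]] := @martingale_infinite_variation R.
have bb := block_bound Nlt FN.
have FC s : `|F s| <= 2.
  by have := bb 0%N s; rewrite N0 take0 F0 subr0 expr0 mulr1; exact.
have [ns [M [ns0 hst Mlt hns pre]]] :=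
  steps_exist (step_exists ons comp mart FC).
have sns k : size (ns k) = k by have [] := hns k.
have Mmono : {homo M : i j / (i <= j)%N}.
  by apply: homo_leq leq_trans _ => // i; exact: ltnW.
have preb j k (x : R) : (j <= k)%N -> take j (bits (ns k) x) = bits (ns j) x.
  by move=> jk; rewrite /bits -map_take pre.
pose v k := digit_fun F (ns k).
(* After time N i, all values of the martingale are within 2 * 2^-i of the one at
   time N i. *)
have vclose i j k x : (N i <= j)%N -> (N i <= k)%N ->
    `|v k x - v j x| <= 4 * 2^-1 ^+ i.
  move=> ij ik.
  have h m : (N i <= m)%N -> `|v m x - F (bits (ns (N i)) x)| <= 2 * 2^-1 ^+ i.
    by move=> im; have := bb i (bits (ns m) x); rewrite size_map sns preb//; exact.
  rewrite -(subrKA (F (bits (ns (N i)) x))); apply: le_trans (ler_normD _ _) _.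
  have h1 := h k ik; have := h j ij; rewrite distrC => h2.
  by have -> : 4 * 2^-1 ^+ i = 2 * 2^-1 ^+ i + 2 * 2^-1 ^+ i :> R; [ring|exact: lerD].
have [u [ucv uv]] := uniform_limit vclose.
have mv k : measurable_fun T01 (v k) by exact: measurable_bits.
have mu_ : measurable_fun T01 u.
  by apply: (measurable_fun_cvg (h := v)) => // x _; exact: ucv.
have v0 x : v 0%N x = 0 by rewrite /v /digit_fun ns0.
have u4 x : `|u x| <= 4.
  by have := uv 0%N 0%N x; rewrite N0 v0 subr0 expr0 mulr1; exact.
have hu : L2 u by apply: (L2_bounded mu_ (C := 4)).
have FC' k x : `|v k x| <= 2 by exact: FC.
have hv k : L2 (v k) by apply: (L2_bounded (mv k) (C := 2)) => x _; exact: FC.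
pose f := real_fun u.
pose dlt k : R := 2^-1 ^+ k / (M k).+1%:R.
have p0 k : 0 < 2^-1 ^+ k :> R by rewrite exprn_gt0// invr_gt0.
have dlt0 k : 0 < dlt k by rewrite divr_gt0.
(* By [tail_coef], all later increments together change the coefficients of index
   at most M k by O(2^-k / (M k + 1)). *)
have coefs k l : (l <= M k)%N ->
    cmod (inner f (phi l) - inner (real_fun (v k)) (phi l)) ^+ 2 <= 8 * dlt k ^+ 2.
  move=> lM; have [c1 c2] := cphi l.
  have hj j : (k <= j)%N -> (l <= M j)%N by move=> /Mmono; exact: leq_trans.
  have r1 : `|ip (fun x => u x - v k x) (@complex.Re R \o phi l)| <= 2 * dlt k.
    apply: (tail_coef Mmono mv FC' mu_ u4 uv) => // j /hj lj.
    by have [n [_ _ _ + _]] := hst j; move=> /(_ l lj)[].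
  have r2 : `|ip (fun x => u x - v k x) (@complex.Im R \o phi l)| <= 2 * dlt k.
    apply: (tail_coef Mmono mv FC' mu_ u4 uv) => // j /hj lj.
    by have [n [_ _ _ + _]] := hst j; move=> /(_ l lj)[].
  rewrite !inner_real// cmod2/=.
  have e psi : L2 psi -> ip u psi - ip (v k) psi = ip (fun x => u x - v k x) psi.
    move=> hpsi; have -> : (fun x => u x - v k x) = (fun x => u x + -1 * v k x).
      by apply/funext => x; rewrite mulN1r.
    by rewrite ipDl ?ipZl ?mulN1r//; exact: L2Z.
  rewrite -opprD sqrrN !e//.
  have sq (a : R) : `|a| <= 2 * dlt k -> a ^+ 2 <= 4 * dlt k ^+ 2.
    move=> h; rewrite -real_normK ?num_real//.
    have -> : 4 * dlt k ^+ 2 = (2 * dlt k) ^+ 2 by ring.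
    by rewrite ler_pXn2r ?nnegrE// mulr_ge0// ltW.
  by have := sq _ r1; have := sq _ r2; lra.
(* The error splits into the expansion of f minus its k-th approximation, whose
   coefficients are tiny, and the error of expanding that approximation. *)
pose err k x := partial_sum phi f (M k) x - real_fun (v k) x.
have cps g m : cL2 (partial_sum phi g m) by exact: cL2_partial_sum.
have cerr k : cL2 (err k) by apply: cL2B; [exact: cps|exact: cL2_real].
have errS k : sqnorm (err k.+1) <= 20 * 2^-1 ^+ k.+1.
  pose g := real_fun (v k.+1).
  pose b x := \sum_(l < (M k.+1).+1) (inner f (phi l) - inner g (phi l)) * phi l x.
  have -> : err k.+1 = (fun x => b x - (g x - partial_sum phi g (M k.+1) x)).
    apply/funext => x; rewrite /err -/g opprB addrA; congr (_ - _).
    rewrite /b /partial_sum -big_split; apply: eq_bigr => l _ /=.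
    by rewrite -mulrDl subrK.
  have hb : sqnorm b <= 8 * 2^-1 ^+ k.+1.
    rewrite /b (@sqnorm_sum _ phi (fun l => inner f (phi l) - inner g (phi l)))//.
    apply: (@le_trans _ _ (\sum_(l < (M k.+1).+1) 8 * dlt k.+1 ^+ 2)).
      by apply: ler_sum => l _; apply: coefs; rewrite -ltnS.
    rewrite sumr_const card_ord -[leLHS]mulr_natl /dlt.
    set m : R := (M k.+1).+1%:R; set q : R := 2^-1 ^+ k.+1.
    have m1 : 1 <= m by rewrite ler1n.
    have q1 : q <= 1 by rewrite exprn_ile1// ?invr_ge0// invf_le1// ler1n.
    have q0 : 0 < q by exact: p0.
    have -> : m * (8 * (q / m) ^+ 2) = 8 * q * (q / m).
      by field; rewrite gt_eqF// (lt_le_trans _ m1).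
    rewrite ler_piMr ?mulr_ge0 ?(ltW q0)// ler_pdivrMr ?(lt_le_trans _ m1)// mul1r.
    exact: le_trans m1.
  have ha : sqnorm (fun x => g x - partial_sum phi g (M k.+1) x) <= 2^-1 ^+ k.
    by have [n []] := hst k.
  have cg : cL2 g by exact: cL2_real.
  have cb : cL2 b.
    exact: (cL2_sum (M k.+1).+1 (fun l => inner f (phi l) - inner g (phi l)) cphi).
  apply: le_trans (sqnormB_le cb (cL2B cg (cps g (M k.+1)))) _.
  by move: hb ha; rewrite exprS; lra.
have errk k : sqnorm (err k) <= (20 + sqnorm (err 0%N)) * 2^-1 ^+ k.
  case: k => [|k]; first by rewrite expr0 mulr1 lerDr.
  apply: le_trans (errS k) _; rewrite ler_wpM2r ?(ltW (p0 _))// lerDl.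
  exact: sqnorm_ge0.
exists f; split; first by apply: (@inLoo_real _ _ _ 4).
have ae1 := ae_square_summable cerr errk.
(* The event that block i fails to contribute, read off the first N (i + 1) bits. *)
pose H i s := `[< ~ var_ge1 (fun k => F (take k s)) (N i) (N i.+1) >].
have ae2 : {ae @lebesgue_measure R, forall x, T01 x ->
    forall m, exists2 i, (m <= i)%N & ~~ H i (bits (ns (N i.+1)) x)}.
  by apply: ae_bits => [i|i]; [by have [] := hns (N i.+1)|rewrite sns; exact: bad].
apply: (@filterS2 _ _ (ae_filter_ringOfSetsType (@lebesgue_measure R))) ae1 ae2 => x h1 h2 xT.
have [C hC] := h1 xT.
apply: (V2_infinite (u := v ^~ x) (e := err ^~ x) Nlt Mlt _ _ hC).
  move=> m; have [i mi /asboolPn/contrapT[w w1 pw]] := h2 xT m.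
  exists i => //; exists w => //.
  apply: (var_congr (N := N i.+1)) pw => // k kN.
  by rewrite preb.
by move=> k _; rewrite /err addrC subrK.
Qed.
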